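(* Let $\mathbf s=\{s_{i_1,i_2,\dots,i_n}\}_{i_1,\dots,i_n=0}^{2\mathfrak n-2}$ be a sequence of real numbers. For $J=(j_2,\dots,j_n)\in\{0,\dots,2\mathfrak n-2\}^{n-1}$ let $\mathfrak s_J=\{\mathfrak s_{i,j_2,\dots,j_n}\}_{i=0}^{2\mathfrak n-2}$ be the associated sequence, let $\{n^{J}_j\}_{j=1}^{N_J}$ be the set of normal indices of $\mathfrak s_J$, where $n^{J}_{N_J}=\mathfrak n$, and let $A=\{\alpha_J\}_{j_2,\dots,j_n=0}^{2\mathfrak n-2}$ be a sequence of real numbers such that each associated sequence $\mathfrak s_J$ is $\alpha_J$-regular (all notions are defined in the context). Then any solution $F$ of the problem $\mathbf{MP}(\mathbf s,2\mathfrak n-2)$ admits the representation $$F(z_1,\dots,z_n)=\sum_{j_2,\dots,j_n=0}^{2\mathfrak n-2}\frac{1}{\prod_{i=2}^n z_i^{j_i+1}}\cdot\cfrac{1}{-(z_1-\alpha_J)m_1^{AJ}(z_1)+\cfrac{1}{l_1^{AJ}+\cdots+\cfrac{1}{-(z_1-\alpha_J)m_{N_J}^{AJ}(z_1)+\cfrac{1}{\tau_J(z_1)}}}},$$ where the parameters $\tau_J$ satisfy $\dfrac{1}{\tau_J(z_1)}=o(z_1)$ as $z_1\widehat{\rightarrow}\infty$, and the atoms $(m_j^{AJ},l_j^{AJ})$ are calculated by the shifted S-fraction formulas in the context. Furthermore, this can be represented as $$F(z_1,\dots,z_n)=\sum_{j_2,\dots,j_n=0}^{2\mathfrak n-2}\frac{1}{\prod_{i=2}^n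 z_i^{j_i+1}}\;\frac{Q^{+AJ}_{2N_J-1}(z_1)\,\tau_J(z_1)+Q^{+AJ}_{2N_J-2}(z_1)}{P^{+AJ}_{2N_J-1}(z_1)\,\tau_J(z_1)+P^{+AJ}_{2N_J-2}(z_1)},$$ where $P^{+AJ}_j$ and $Q^{+AJ}_j$ are the Stieltjes polynomials with the shift $\alpha_J$, of the first and second kind, associated with $\mathfrak s_J$ (defined in the context).
   Context: **Limits.** A Stolz domain with centre $0$ and angle $\theta\in(0,\pi/2]$ is $\{z\in\mathbb C^+:\theta<\arg z<\pi-\theta\}$; $z\widehat{\rightarrow}\infty$ denotes the limit $|z|\to\infty$ in any such Stolz domain. **The problem $\mathbf{MP}(\mathbf s,\ell)$.** Given a sequence of real numbers $\mathbf s=\{s_{i_1,\dots,i_n}\}_{i_1,\dots,i_n=0}^{\ell}$, describe the set of functions $F$ (the solutions) such that $$F(z_1,\dots,z_n)=-\sum_{k=0}^{n\ell}\ \sum_{\substack{\alpha_i\ge0\\ \alpha_1+\dots+\alpha_n=k}}\binom{k}{\alpha_1,\dots,\alpha_n}\frac{s_{\alpha_1,\dots,\alpha_n}}{z_1^{\alpha_1+1}\cdots z_n^{\alpha_n+1}}+o\Bigg(\sum_{\substack{\alpha_i\ge0\\ \alpha_1+\dots+\alpha_n=n\ell}}\frac{1}{z_1^{\alpha_1+1}\cdots z_n^{\alpha_n+1}}\Bigg),\quad z_i\widehat{\rightarrow}\infty,$$ with multinomial coefficients. **Associated sequences.** For $J=(j_2,\dots,j_n)$, $\mathfrak s_J=\{\mathfrak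 s_{i,j_2,\dots,j_n}\}_{i=0}^{\ell}$ with $$\mathfrak s_{i,j_2,\dots,j_n}=\binom{i+j_2+\dots+j_n}{i,j_2,\dots,j_n}s_{i,j_2,\dots,j_n}.$$ In terms of these sequences the expansion above is rewritten as $$F(z_1,\dots,z_n)=\sum_{j_2,\dots,j_n=0}^{\ell}\frac{F_J(z_1)}{z_2^{j_2+1}\cdots z_n^{j_n+1}},\qquad F_J(z_1)=-\frac{\mathfrak s_{0,j_2,\dots,j_n}}{z_1}-\dots-\frac{\mathfrak s_{\ell,j_2,\dots,j_n}}{z_1^{\ell+1}}+o\left(\frac1{z_1^{\ell+1}}\right),\quad z_1\widehat{\rightarrow}\infty.$$ **Objects attached to a real sequence** $c=\{c_i\}_{i=0}^{2\mathfrak n-2}$ and $\alpha\in\mathbb R$ (applied to $c=\mathfrak s_J$, $\alpha=\alpha_J$; the superscripts $J$, $AJ$ indicate this). *Normal indices:* the indices $m$ with $D_m:=\det(c_{p+q})_{p,q=0}^{m-1}\neq0$, listed as $n_1<\dots<n_N$ (here $n_N=\mathfrak n$). Put $n_0=0$ and $\nu_k=n_k-n_{k-1}$. *P-fraction atoms:* put $c^{(0)}_i=c_i$, and for $k=1,\dots,N-1$, $0\le i\le 2\mathfrak n-2n_k-2$, $$c^{(k)}_i=\frac{(-1)^{i+\nu_k}}{\big(c^{(k-1)}_{\nu_k-1}\big)^{i+\nu_k+1}}\det(T_{pq})_{p,q=1}^{i+\nu_k+1},\qquad T_{pq}=\begin{cases}c^{(k-1)}_{\nu_k+p-q},&q\le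 p+1,\\0,&q>p+1.\end{cases}$$ For $k=0,\dots,N-1$, with $\nu=\nu_{k+1}$ and $D^{(k)}_\nu=\det(c^{(k)}_{p+q})_{p,q=0}^{\nu-1}$, $$b_k=c^{(k)}_{\nu-1},\qquad a_k(z)=\frac1{D^{(k)}_\nu}\begin{vmatrix}c^{(k)}_0&c^{(k)}_1&\dots&c^{(k)}_\nu\\ \vdots&\vdots&&\vdots\\ c^{(k)}_{\nu-1}&c^{(k)}_\nu&\dots&c^{(k)}_{2\nu-1}\\1&z&\dots&z^\nu\end{vmatrix}.$$ The entry $c^{(N-1)}_{2\nu_N-1}$ in $a_{N-1}$, which is not determined by $c_0,\dots,c_{2\mathfrak n-2}$, is a fixed real number. *Polynomials of the first kind:* $P_{n_k}$, $-1\le k\le N$, is the solution of $b_ky_{n_{k-1}}(z)-a_k(z)y_{n_k}(z)+y_{n_{k+1}}(z)=0$, $k=0,\dots,N-1$, with $P_{n_{-1}}\equiv0$, $P_{n_0}\equiv1$. *$\alpha$-regularity:* $c$ is called $\alpha$-regular if $P_{n_j}(\alpha)\neq0$ for all $j=1,\dots,N$. *Shifted S-fraction atoms:* $$d^A_1=\frac1{b_0},\qquad l^A_1=-\frac1{d^A_1a_0(\alpha)},\qquad d^A_j=\frac1{b_{j-1}(l^A_{j-1})^2d^A_{j-1}},\qquad l^A_j=-\frac{l^A_{j-1}}{1+l^A_{j-1}d^A_ja_{j-1}(\alpha)},$$ $$m^A_j(z)=\frac{\big(a_{j-1}(z)-a_{j-1}(\alpha)\big)d^A_j}{z-\alpha},$$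 where $d^A_j$ is the leading coefficient of the polynomial $m^A_j$. *Stieltjes polynomials with shift $\alpha$:* $P^{+A}_k$ and $Q^{+A}_k$ are the solutions of $$y_{2j}(z)-y_{2j-2}(z)=l^A_j\,y_{2j-1}(z),\qquad y_{2j+1}(z)-y_{2j-1}(z)=-(z-\alpha)m^A_{j+1}(z)\,y_{2j}(z)$$ subject to $P^{+A}_{-1}\equiv0$, $P^{+A}_0\equiv1$, $Q^{+A}_{-1}\equiv1$, $Q^{+A}_0\equiv0$.
   Formalization: A solution of MP(s,l) is taken in the rewritten form F = sum of F_J(z_1)/prod z_i^(j_i+1), each F_J having its own remainder o(1/z_1^(l+1)); with the single joint remainder the claim fails for n>=2 (l=0: add 1/(z_1 z_2)^2). *)

(* Defs.v *)
From HB Require Import structures.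
From mathcomp Require Import all_boot all_order all_algebra.
From mathcomp Require Import complex.
From mathcomp Require Import all_classical all_reals all_analysis.

Set Implicit Arguments.
Unset Strict Implicit.
Unset Printing Implicit Defensive.

Import Order.TTheory GRing.Theory Num.Theory.
Import numFieldNormedType.Exports.

Local Open Scope classical_set_scope.
Local Open Scope ring_scope.
Local Open Scope complex_scope.

Section StolzDomain.
Variable R : realType.
Implicit Types (theta : R) (z : R[i]).

(* theta < arg z < pi - theta, with arg z given by polar coordinates. *)
Definition stolz theta : set R[i] :=
  [set z | exists r t : R, [/\ 0 < r, theta < t, t < pi - theta
                             & z = (r * cos t) +i* (r * sin t)]].

(* The filter of |z| -> oo inside the Stolz domain of angle theta.  It is
   improper for theta = pi / 2, where the domain is empty. *)
Definition stolz_infty theta : set_system R[i] :=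
  [set A | exists M : R, forall z, stolz theta z -> M%:C < `|z| -> A z].

#[global] Instance stolz_infty_filter theta : Filter (stolz_infty theta).
Proof.
split; first by exists 0.
- move=> A B [M AM] [N BN]; exists (Num.max M N) => z zs zMN.
  have lt_norm x : x <= Num.max M N -> x%:C < `|z|.
    by move=> xMN; apply: le_lt_trans zMN; rewrite lecR.
  split; first by apply: AM => //; apply: lt_norm; rewrite le_max lexx.
  by apply: BN => //; apply: lt_norm; rewrite le_max lexx orbT.
- by move=> A B AB [M AM]; exists M => z zs Mz; apply/AB/AM.
Qed.

Canonical stolz_infty_filter_on theta :=
  FilterType (stolz_infty theta) (stolz_infty_filter theta).

(* f = g + o(e) as |z| -> oo in every Stolz domain. *)
Definition stolz_eqo (f g e : R[i] -> R[i]) : Prop :=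
  forall theta, 0 < theta -> theta <= pi / 2 ->
    (f : R[i] -> R[i]^o) = (g : R[i] -> R[i]^o)
      +o_ (stolz_infty theta) (e : R[i] -> R[i]^o).

Definition peval (p : {poly R}) z : R[i] := (map_poly (real_complex R) p).[z].

End StolzDomain.

(* The extended complex plane; None is the point at infinity.  Here
   0^-1 = oo, oo^-1 = 0 and a + oo = oo. *)
Section ExtendedPlane.
Variable R : realType.

Definition ecomplex := option R[i].

Definition einv (w : ecomplex) : ecomplex :=
  if w is Some x then (if x == 0 then None else Some x^-1) else Some 0.

Definition eadd (a : R[i]) (w : ecomplex) : ecomplex := omap (+%R a) w.

(* 1/(e_1 + 1/(e_2 + ... + 1/(e_r + w))) *)
Definition cfrac (e : seq R[i]) (w : ecomplex) : ecomplex :=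
  foldr (fun a v => einv (eadd a v)) w e.

(* (a w + b) / (c w + d), equal to a / c at w = oo. *)
Definition mobius (a b c d : R[i]) (w : ecomplex) : ecomplex :=
  let: (num, den) := if w is Some x then (a * x + b, c * x + d) else (a, c) in
  if den == 0 then None else Some (num / den).

Definition finite_part (w : ecomplex) : R[i] := odflt 0 w.

End ExtendedPlane.

(* c is a sequence c_0, ..., c_(2 nn - 2), of which only these terms are used;
   t is the fixed value of the undetermined entry c^(N-1)_(2 nu_N - 1). *)
Section SequenceObjects.
Variables (R : realType) (c : nat -> R) (nn : nat) (t alpha : R).

Definition hankel_det (u : nat -> R) (m : nat) : R :=
  \det (\matrix_(p < m, q < m) u (p + q)%N).

Definition normal_indices : seq nat :=
  [seq m <- iota 1 nn | hankel_det c m != 0].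

Definition Nn : nat := size normal_indices.

(* n_k for 0 <= k <= N, with n_0 = 0 *)
Definition nidx (k : nat) : nat := nth 0%N (0%N :: normal_indices) k.

(* nu_k = n_k - n_(k-1) for 1 <= k <= N *)
Definition nu (k : nat) : nat := (nidx k - nidx k.-1)%N.

(* The condition q <= p + 1 and the index nu_k + p - q are unchanged by
   numbering rows and columns from 0. *)
Fixpoint cseq (k : nat) : nat -> R :=
  if k is k'.+1 then fun i =>
    (-1) ^+ (i + nu k) / cseq k' (nu k).-1 ^+ (i + nu k).+1 *
    \det (\matrix_(p < (i + nu k).+1, q < (i + nu k).+1)
            if (q <= p.+1)%N then cseq k' (nu k + p - q)%N else 0)
  else c.

Definition centry (k i : nat) : R :=
  if (k == Nn.-1) && (i == (nu Nn).*2.-1) then t else cseq k i.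

Definition atom_b (k : nat) : R := cseq k (nu k.+1).-1.

Definition atom_a (k : nat) : {poly R} :=
  (hankel_det (cseq k) (nu k.+1))^-1 *:
  \det (\matrix_(p < (nu k.+1).+1, q < (nu k.+1).+1)
          if (p < nu k.+1)%N then (centry k (p + q))%:P else 'X^q).

(* The pair (P_(n_(k-1)), P_(n_k)), starting from P_(n_(-1)) = 0, P_(n_0) = 1. *)
Fixpoint first_kind_pair (k : nat) : {poly R} * {poly R} :=
  if k is k'.+1 then
    let: (y0, y1) := first_kind_pair k' in
    (y1, atom_a k' * y1 - atom_b k' *: y0)
  else (0, 1).

Definition first_kind (k : nat) : {poly R} := (first_kind_pair k).2.

Definition regular : Prop :=
  forall j : nat, (1 <= j <= Nn)%N -> (first_kind j).[alpha] != 0.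

(* (d^A_(k+1), l^A_(k+1)) *)
Fixpoint atom_dl (k : nat) : R * R :=
  if k is k'.+1 then
    let: (d0, l0) := atom_dl k' in
    let d1 := (atom_b k * l0 ^+ 2 * d0)^-1 in
    (d1, - (l0 / (1 + l0 * d1 * (atom_a k).[alpha])))
  else
    let d1 := (atom_b 0)^-1 in (d1, - (d1 * (atom_a 0).[alpha])^-1).

(* Numbered from j = 1, as are the atoms (m^A_j, l^A_j). *)
Definition atom_d (j : nat) : R := (atom_dl j.-1).1.
Definition atom_l (j : nat) : R := (atom_dl j.-1).2.
Definition atom_m (j : nat) : {poly R} :=
  (atom_d j *: (atom_a j.-1 - (atom_a j.-1).[alpha]%:P)) %/ ('X - alpha%:P).

(* The pair (y_(2j-1), y_(2j)) of the solution with initial values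
   (y_(-1), y_0) = init. *)
Fixpoint stieltjes_pair (init : {poly R} * {poly R}) (j : nat) :
    {poly R} * {poly R} :=
  if j is j'.+1 then
    let: (y_odd, y_even) := stieltjes_pair init j' in
    let y_odd' := y_odd - ('X - alpha%:P) * atom_m j * y_even in
    (y_odd', y_even + atom_l j *: y_odd')
  else init.

Definition Podd (j : nat) : {poly R} := (stieltjes_pair (0, 1) j).1.
Definition Peven (j : nat) : {poly R} := (stieltjes_pair (0, 1) j).2.
Definition Qodd (j : nat) : {poly R} := (stieltjes_pair (1, 0) j).1.
Definition Qeven (j : nat) : {poly R} := (stieltjes_pair (1, 0) j).2.

(* -(z - alpha) m_1(z), l_1, -(z - alpha) m_2(z), l_2, ..., -(z - alpha) m_N(z) *)
Definition sfrac_entries (z : R[i]) : seq R[i] :=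
  let me j := - (z - alpha%:C) * peval (atom_m j) z in
  rcons (flatten [seq [:: me j; (atom_l j)%:C] | j <- iota 1 Nn.-1]) (me Nn).

Definition sfrac (z : R[i]) (tau : ecomplex R) : ecomplex R :=
  cfrac (sfrac_entries z) (einv tau).

(* (Q_(2N-1) tau + Q_(2N-2)) / (P_(2N-1) tau + P_(2N-2)) *)
Definition sfrac_mobius (z : R[i]) (tau : ecomplex R) : ecomplex R :=
  mobius (peval (Qodd Nn) z) (peval (Qeven Nn.-1) z)
         (peval (Podd Nn) z) (peval (Peven Nn.-1) z) tau.

End SequenceObjects.

(* n.+1 variables z_1, ..., z_(n+1); J = (j_2, ..., j_(n+1)). *)
Section MultidimensionalProblem.
Variables (R : realType) (n l : nat).

Definition mindex := n.-tuple 'I_l.+1.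

Definition multinomial (a : seq nat) : nat :=
  ((sumn a)`! %/ \prod_(x <- a) x`!)%N.

(* Only the values at i <= l are meaningful. *)
Definition associated (s : n.+1.-tuple 'I_l.+1 -> R) (J : mindex) (i : nat) : R :=
  (multinomial (i :: [seq val j | j <- J]))%:R * s [tuple of inord i :: J].

Definition upper_half (z : n.+1.-tuple R[i]) : Prop :=
  forall i, 0 < complex.Im (tnth z i).

Definition multi_sum (G : mindex -> R[i]) (z : n.+1.-tuple R[i]) : R[i] :=
  \sum_(J : mindex)
    (\prod_(i < n) tnth z (lift ord0 i) ^+ (tnth J i).+1)^-1 * G J.

(* The expansion of the problem MP(s, l) written through the associated
   sequences.  The single remainder o(sum_(|a| = n l) z^-(a+1)) is read, as in
   this form, as a remainder o(z_1^-(l+1)) in each coefficient F_J(z_1). *)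
Definition MP_solution (s : n.+1.-tuple 'I_l.+1 -> R)
    (F : n.+1.-tuple R[i] -> R[i]) : Prop :=
  exists FJ : mindex -> R[i] -> R[i],
    (forall z, upper_half z -> F z = multi_sum (FJ^~ (thead z)) z) /\
    (forall J, stolz_eqo (FJ J)
       (fun z => - \sum_(i < l.+1) (associated s J i)%:C / z ^+ i.+1)
       (fun z => (z ^+ l.+1)^-1)).

(* F(z) = sum_J G_J(z_1) / prod_i z_i^(j_i + 1), all the values G_J(z_1) being
   finite. *)
Definition represents (F : n.+1.-tuple R[i] -> R[i])
    (G : mindex -> R[i] -> ecomplex R) : Prop :=
  forall z, upper_half z ->
    (forall J, G J (thead z) <> None) /\
    F z = multi_sum (fun J => finite_part (G J (thead z))) z.

End MultidimensionalProblem.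

(* 1/tau(z) = o(z); in particular 1/tau is finite near infinity. *)
Definition admissible (R : realType) (tau : R[i] -> ecomplex R) : Prop :=
  (forall theta : R, 0 < theta -> theta <= pi / 2 ->
     \forall z \near stolz_infty theta, einv (tau z) <> None) /\
  stolz_eqo (fun z => finite_part (einv (tau z))) (fun=> 0) id.

(* Main.v *)
From HB Require Import structures.
Require Import Defs.
From mathcomp Require Import all_boot all_order all_algebra.
From mathcomp Require Import complex ring zify.
From mathcomp Require Import all_classical all_reals all_analysis.

Set Implicit Arguments.
Unset Strict Implicit.
Unset Printing Implicit Defensive.

Import Order.TTheory GRing.Theory Num.Theory.
Import numFieldNormedType.Exports.

Local Open Scope ring_scope.
Local Open Scope complex_scope.

(** The problem splits over the multi-indices J, so fix J and write f for the
    coefficient F_J, c for the associated sequence, and N for the number of its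
    normal indices n_1 < ... < n_N; then f(z) = - sum_i c_i / z^(i+1) + o(...).

    Each map w |-> 1/(a + w) is a bijection of the extended plane, and the
    recurrences of the Stieltjes polynomials are those of the convergents.  So
    the finite continued fraction and the linear fractional expression are the
    same function of tau (sfrac_sfrac_mobius), and the latter has determinant 1
    (stieltjes_det).  For every z there is therefore a tau(z) giving the value
    f(z), namely
      tau = (P^+_(2N-2) f - Q^+_(2N-2)) / (Q^+_(2N-1) - P^+_(2N-1) f),
    and the only real content is the estimate 1/tau(z) = o(z).

    By regularity P^+_(2j) = P_(n_j) / P_(n_j)(alpha), and P^+_(2j-1) is a
    constant combination of P_(n_j) and P_(n_(j-1)); the same combinations give
    the polynomials of the second kind.  Hence 1/tau is an affine function of
    R_N / R_(N-1), where R_k = f P_(n_k) - Q_(n_k) satisfies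
    R_(k+1) = a_k R_k - b_k R_(k-1).

    The asymptotics of R_k are computed with formal series in x = 1/z.  If phi_k
    is the generating series of c^(k), the determinant formula for c^(k+1) says
    that a_k(z) - x phi_(k+1)(x) = b_k / (x phi_k(x)) (conv_reciprocal, cseqS,
    atom_aE_polynomial_part); for k = N - 1 this holds up to an additive constant,
    the effect of t.  Since R_(-1) = -1, it follows that R_k has for k < N the
    expansion -rho_k with rho_(-1) = 1 and rho_k = x phi_k rho_(k-1)
    (residual_recurrence, expansion_rem), and R_N differs from such a remainder by
    a multiple of R_(N-1).  The coefficients of rho_k are also the moments
    S(t^i P_(n_k)), S being the functional t^i |-> c_i, so the kernels of the
    Hankel matrices show that rho_k starts exactly at x^(n_(k+1))
    (hankel_gap, residual_order); this also gives b_k != 0 and the vanishing of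
    the first nu_(k+1) - 1 terms of c^(k).  With n_N = nn this yields
    R_(N-1) ~ C z^(-nn), C != 0, and R_N = o(z^(1-nn)), hence
    R_N / R_(N-1) = o(z). *)

(** * Continued fractions in the extended plane *)

Section ContinuedFraction.
Variable R : realType.
Implicit Types (x y a b : R[i]) (e : seq R[i]).

(** The point of the extended plane with homogeneous coordinates (x : y).  The
    pair (0, 0) is sent to infinity. *)
Definition ratio x y : ecomplex R := if y == 0 then None else Some (x / y).

Lemma ratioZ a x y : a != 0 -> ratio (a * x) (a * y) = ratio x y.
Proof.
move=> a0; rewrite /ratio mulf_eq0 (negPf a0) /=; case: eqVneq => // y0.
by rewrite -mulf_div divff // mul1r.
Qed.

Lemma ratioP (w : ecomplex R) :
  exists x y, (x != 0) || (y != 0) /\ w = ratio x y.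
Proof.
case: w => [x|]; last by exists 1, 0; rewrite oner_eq0 /ratio eqxx.
by exists x, 1; rewrite oner_eq0 orbT /ratio oner_eq0 divr1.
Qed.

Lemma einv_ratio x y : (x != 0) || (y != 0) -> einv (ratio x y) = ratio y x.
Proof.
rewrite /ratio; case: (eqVneq y 0) => [->|y0] /=.
  by rewrite orbF => x0; rewrite (negPf x0) mul0r.
move=> _; rewrite mulf_eq0 invr_eq0 (negPf y0) orbF.
by case: eqVneq => // x0; rewrite invf_div.
Qed.

(** This needs no hypothesis on (x, y): with the value 0 at infinity and
    0^-1 = 0 in the field, all degenerate cases agree. *)
Lemma finite_part_einv_ratio x y : finite_part (einv (ratio x y)) = y / x.
Proof.
rewrite /ratio; case: (eqVneq y 0) => [->|y0] /=; first by rewrite mul0r.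
rewrite mulf_eq0 invr_eq0 (negPf y0) orbF.
by case: eqVneq => [->|x0] /=; rewrite ?invr0 ?mulr0 // invf_div.
Qed.

Lemma eadd_ratio a x y : eadd a (ratio x y) = ratio (x + a * y) y.
Proof.
rewrite /ratio; case: eqVneq => //= y0; congr Some.
by rewrite mulrDl mulfK // addrC.
Qed.

Lemma cfrac_cons_ratio a x y : (x != 0) || (y != 0) ->
  cfrac [:: a] (ratio x y) = ratio y (x + a * y).
Proof.
move=> xy; rewrite /= eadd_ratio einv_ratio //.
by case: (eqVneq y 0) xy => [->|_ _]; rewrite ?orbT // mulr0 addr0.
Qed.

Lemma cfrac_cat e1 e2 w : cfrac (e1 ++ e2) w = cfrac e1 (cfrac e2 w).
Proof. exact: foldr_cat. Qed.

Lemma mobius_ratio a b c d x y : (x != 0) || (y != 0) ->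
  mobius a b c d (ratio x y) = ratio (a * x + b * y) (c * x + d * y).
Proof.
rewrite {1}/ratio; case: (eqVneq y 0) => [->|y0 _].
  rewrite orbF => x0 /=; rewrite !mulr0 !addr0 ![_ * x]mulrC ratioZ //.
by rewrite /mobius -/(ratio _ _) -(@ratioZ y) //; congr ratio; field.
Qed.

End ContinuedFraction.

Section Evaluation.
Variable R : realType.
Implicit Types z : R[i].

Lemma pevalD (p q : {poly R}) z : peval (p + q) z = peval p z + peval q z.
Proof. by rewrite /peval rmorphD hornerD. Qed.
Lemma pevalN (p : {poly R}) z : peval (- p) z = - peval p z.
Proof. by rewrite /peval rmorphN hornerN. Qed.
Lemma pevalM (p q : {poly R}) z : peval (p * q) z = peval p z * peval q z.
Proof. by rewrite /peval rmorphM hornerM. Qed.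
Lemma pevalC (a : R) z : peval a%:P z = a%:C.
Proof. by rewrite /peval map_polyC hornerC. Qed.
Lemma pevalZ (a : R) (p : {poly R}) z : peval (a *: p) z = a%:C * peval p z.
Proof. by rewrite -mul_polyC pevalM pevalC. Qed.
Lemma pevalX z : peval 'X z = z.
Proof. by rewrite /peval map_polyX hornerX. Qed.
Definition pevalE := (pevalD, pevalN, pevalM, pevalZ, pevalC, pevalX).

End Evaluation.

Section StieltjesFraction.
Variables (R : realType) (c : nat -> R) (nn : nat) (t alpha : R).
Hypothesis N_gt0 : (0 < Nn c nn)%N.
Local Notation N := (Nn c nn).
Local Notation m := (atom_m c nn t alpha).
Local Notation l := (atom_l c nn t alpha).
Local Notation stp := (stieltjes_pair c nn t alpha).
Implicit Types z x y : R[i].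

Lemma stieltjes_odd init j : (stp init j.+1).1 =
  (stp init j).1 - ('X - alpha%:P) * m j.+1 * (stp init j).2.
Proof. by rewrite /=; case: (stp init j). Qed.

Lemma stieltjes_oddN init : (stp init N).1 =
  (stp init N.-1).1 - ('X - alpha%:P) * m N * (stp init N.-1).2.
Proof. by rewrite -[in LHS](prednK N_gt0) stieltjes_odd prednK. Qed.

Lemma stieltjes_even init j :
  (stp init j.+1).2 = (stp init j).2 + l j.+1 *: (stp init j.+1).1.
Proof. by rewrite /=; case: (stp init j). Qed.

(* The entry of the continued fraction of odd rank 2 j - 1. *)
Let me z j := - (z - alpha%:C) * peval (m j) z.

(** The 2 j-th convergent, acting on homogeneous coordinates. *)
Lemma cfrac_stieltjes z j x y : (x != 0) || (y != 0) ->
  cfrac (flatten [seq [:: me z i; (l i)%:C] | i <- iota 1 j]) (ratio x y) =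
  ratio (peval (Qodd c nn t alpha j) z * x + peval (Qeven c nn t alpha j) z * y)
        (peval (Podd c nn t alpha j) z * x + peval (Peven c nn t alpha j) z * y).
Proof.
rewrite /Qodd /Qeven /Podd /Peven.
elim: j x y => [|j IHj] x y xy.
  by rewrite /= -polyC1 -polyC0 !pevalC !(mul1r, mul0r) addr0 add0r.
have -> : iota 1 j.+1 = iota 1 j ++ [:: j.+1] by rewrite -{1}(addn1 j) iotaD.
rewrite map_cat flatten_cat cfrac_cat /=.
rewrite eadd_ratio einv_ratio; last first.
  by case: (eqVneq y 0) xy => [->|_ _]; rewrite ?orbT // mulr0 addr0.
rewrite eadd_ratio einv_ratio; last first.
  case: (eqVneq (x + (l j.+1)%:C * y) 0) => [e|]; last by rewrite orbT.
  rewrite e mulr0 addr0 orbF.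
  by apply/eqP => y0; move: e xy; rewrite y0 mulr0 addr0 => ->; rewrite eqxx.
rewrite IHj; last first.
  case: (eqVneq (x + (l j.+1)%:C * y) 0) => [e|_] //=.
  rewrite e mulr0 addr0.
  by apply/eqP => y0; move: e xy; rewrite y0 mulr0 addr0 => ->; rewrite eqxx.
rewrite !stieltjes_even !stieltjes_odd !pevalE /me.
by congr ratio; ring.
Qed.

Lemma sfrac_sfrac_mobius z tau :
  sfrac c nn t alpha z tau = sfrac_mobius c nn t alpha z tau.
Proof.
have [x [y [xy ->]]] := ratioP tau.
rewrite /sfrac_mobius mobius_ratio // /sfrac /sfrac_entries -/(me z) einv_ratio //.
rewrite -cats1 cfrac_cat cfrac_cons_ratio 1?orbC //.
rewrite (@cfrac_stieltjes z); last first.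
  case: (eqVneq x 0) xy => [->|_ _] //=; by rewrite mulr0 addr0.
rewrite /Qodd /Podd !stieltjes_oddN !pevalE /me /Qeven /Peven.
by congr ratio; ring.
Qed.

Lemma stieltjes_det j :
  Qodd c nn t alpha j * Peven c nn t alpha j -
  Qeven c nn t alpha j * Podd c nn t alpha j = 1.
Proof.
rewrite /Qodd /Qeven /Podd /Peven; elim: j => [|j IHj].
  by rewrite /= mulr1 mulr0 subr0.
rewrite !stieltjes_even !stieltjes_odd -!mul_polyC -[RHS]IHj; ring.
Qed.

Lemma sfrac_mobius_inv z f :
  sfrac_mobius c nn t alpha z
    (ratio (peval (Peven c nn t alpha N.-1) z * f - peval (Qeven c nn t alpha N.-1) z)
           (peval (Qodd c nn t alpha N) z - peval (Podd c nn t alpha N) z * f))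
  = Some f.
Proof.
set P0 := peval (Peven _ _ _ _ _) z; set Q0 := peval (Qeven _ _ _ _ _) z.
set P1 := peval (Podd _ _ _ _ _) z; set Q1 := peval (Qodd _ _ _ _ _) z.
have D : Q1 * P0 - Q0 * P1 = 1.
  have := congr1 ((@peval R)^~ z) (stieltjes_det N.-1).
  rewrite /= pevalD pevalN !pevalM -/P0 -/Q0 -polyC1 pevalC rmorph1 => <-.
  rewrite /Q1 /P1 /Qodd /Podd !stieltjes_oddN !pevalE.
  by rewrite /P0 /Q0 /Peven /Qeven; ring.
rewrite /sfrac_mobius -/P0 -/Q0 -/P1 -/Q1 mobius_ratio; last first.
  apply: contraT; rewrite negb_or !negbK => /andP[/eqP x0 /eqP y0].
  suff: (1 : R[i]) == 0 by rewrite oner_eq0.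
  rewrite -D; have -> : Q1 = P1 * f by apply/eqP; rewrite -subr_eq0 y0.
  have -> : Q0 = P0 * f by apply/eqP; rewrite eq_sym -subr_eq0 x0.
  by apply/eqP; ring.
rewrite /ratio; have -> : P1 * (P0 * f - Q0) + P0 * (Q1 - P1 * f) = 1.
  by rewrite -D; ring.
rewrite oner_eq0 divr1; congr Some.
by rewrite -[RHS]mul1r -D; ring.
Qed.

End StieltjesFraction.

(** * Stieltjes polynomials through the polynomials of the first and second kind *)

Section ThreeTerm.
Variables (R : realType) (c : nat -> R) (nn : nat) (t alpha : R).
Local Notation N := (Nn c nn).
Local Notation a := (atom_a c nn t).
Local Notation b := (atom_b c nn).
Local Notation stp := (stieltjes_pair c nn t alpha).
Implicit Types init : {poly R} * {poly R}.

(** The pair (y_(n_(k-1)), y_(n_k)) of the solution of the three-term recurrence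
    with given initial pair.  The initial pairs (0, 1) and (1, 0) give the
    polynomials of the first and of the second kind. *)
Fixpoint three_term init (k : nat) : {poly R} * {poly R} :=
  if k is k'.+1 then
    ((three_term init k').2,
     a k' * (three_term init k').2 - b k' *: (three_term init k').1)
  else init.

Lemma first_kind_three_term k : first_kind c nn t k = (three_term (0, 1) k).2.
Proof.
rewrite /first_kind; suff -> : first_kind_pair c nn t k = three_term (0, 1) k by [].
by elim: k => //= k ->; case: (three_term _ k).
Qed.

(* p k = P_(n_k)(alpha) and pm k = P_(n_(k-1))(alpha). *)
Let p k := (first_kind c nn t k).[alpha].
Let pm k := (three_term (0, 1) k).1.[alpha].

Let pm0 : pm 0 = 0. Proof. by rewrite /pm /= horner0. Qed.
Let p0 : p 0 = 1. Proof. by rewrite /p /first_kind /= hornerC. Qed.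
Let pmS k : pm k.+1 = p k. Proof. by rewrite /pm /= -first_kind_three_term. Qed.
Let pS k : p k.+1 = (a k).[alpha] * p k - b k * pm k.
Proof. by rewrite /p !first_kind_three_term /= hornerD hornerN hornerZ hornerM. Qed.

(** The factor of proportionality between the odd Stieltjes polynomials and
    P_(n_(k-1))(alpha) y_(n_k) - P_(n_k)(alpha) y_(n_(k-1)). *)
Definition atom_kappa (k : nat) : R := - (\prod_(i < k) b i)^-1.
Local Notation kappa := atom_kappa.

Hypothesis b_neq0 : forall k, (k < N)%N -> b k != 0.
Hypothesis alpha_regular : regular c nn t alpha.

Let p_neq0 k : (k <= N)%N -> p k != 0.
Proof.
by case: k => [|k] kN; [rewrite p0 oner_eq0 | apply: alpha_regular].
Qed.

Lemma atom_kappaS k : (k < N)%N -> kappa k = b k * kappa k.+1.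
Proof.
by move=> kN; rewrite /kappa big_ord_recr /= invfM mulrN mulrCA mulfV ?mulr1 ?b_neq0.
Qed.

Lemma atom_kappa_neq0 k : (k <= N)%N -> kappa k != 0.
Proof.
move=> kN; rewrite /kappa oppr_eq0 invr_eq0; apply/prodf_neq0 => i _.
by apply: b_neq0; apply: leq_trans kN.
Qed.

(** Closed forms of d^A_(k+1) and l^A_(k+1).  Regularity makes all the
    denominators in their recursive definition nonzero. *)
Lemma atom_dlE k : (k < N)%N ->
  atom_dl c nn t alpha k = (- (p k ^+ 2 * kappa k.+1), (kappa k.+1 * p k.+1 * p k)^-1).
Proof.
elim: k => [|k IHk] kN /=.
  have b0 := b_neq0 kN; have := p_neq0 kN; rewrite pS p0 pm0 mulr0 mulr1 subr0 => a0.
  rewrite /kappa big_ord_recr big_ord0 /= mul1r expr1n mul1r opprK mulr1.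
  by congr pair; rewrite mulNr invrN.
rewrite IHk ?(ltnW kN) //=.
have kN' := ltnW kN; have b1 := b_neq0 kN; have kap2 := atom_kappa_neq0 kN.
have pk := p_neq0 (ltnW kN'); have pk1 := p_neq0 kN'; have := p_neq0 kN.
rewrite atom_kappaS // pS pmS => pk2.
have Ed : (b k.+1 * (b k.+1 * kappa k.+2 * p k.+1 * p k)^-1 ^+ 2 *
     - (p k ^+ 2 * (b k.+1 * kappa k.+2)))^-1 = - (p k.+1 ^+ 2 * kappa k.+2).
  by field; rewrite ?pk ?pk1 ?b1 ?kap2.
congr pair; first exact: Ed.
rewrite Ed; set A := (a k.+1).[alpha] in pk2 *.
have -> : 1 + (b k.+1 * kappa k.+2 * p k.+1 * p k)^-1 *
    - (p k.+1 ^+ 2 * kappa k.+2) * A = - (A * p k.+1 - b k.+1 * p k) / (b k.+1 * p k).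
  by field; rewrite ?pk ?pk1 ?b1 ?kap2.
by field; rewrite ?pk ?pk1 ?b1 ?kap2 ?pk2.
Qed.

Lemma mulXsub_atom_m k :
  ('X - alpha%:P) * atom_m c nn t alpha k.+1 =
  atom_d c nn t alpha k.+1 *: (a k - (a k).[alpha]%:P).
Proof.
rewrite mulrC divpK // dvdp_XsubCl /root hornerZ hornerD hornerN hornerC.
by rewrite subrr mulr0.
Qed.

(* The closed form of the pair (y_(2k-1), y_(2k)). *)
Let pairE init k : {poly R} * {poly R} :=
  (kappa k *: (pm k *: (three_term init k).2 - p k *: (three_term init k).1),
   (p k)^-1 *: (three_term init k).2).

Let stieltjes_oddS init k : (k < N)%N -> stp init k = pairE init k ->
  (stp init k.+1).1 = (pairE init k.+1).1.
Proof.
move=> kN E; rewrite stieltjes_odd E mulXsub_atom_m /atom_d atom_dlE //.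
rewrite /pairE pmS pS atom_kappaS //=.
have := p_neq0 (ltnW kN); set q := p k => q0.
set y := (three_term _ _).2; set x := (three_term _ _).1; set A := (a k).[alpha].
have -> : y = q *: (q^-1 *: y) by rewrite scalerA mulfV // scale1r.
set w := q^-1 *: y; rewrite [q^-1 *: (q *: w)]scalerA mulVf // scale1r.
by rewrite -!mul_polyC !(polyCM, polyCN, polyCD, polyC_exp); ring.
Qed.

Let stieltjes_pairE init k : (k < N)%N ->
  stp init k = pairE init k.
Proof.
elim: k => [|k IHk] kN.
  rewrite /pairE /atom_kappa /= big_ord0 pm0 p0 !invr1 !scale1r scale0r sub0r.
  by rewrite scaleN1r opprK; by case: init.
have E := IHk (ltnW kN); have O := stieltjes_oddS (ltnW kN) E.
rewrite [LHS]surjective_pairing stieltjes_even O E /pairE pmS.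
rewrite /atom_l atom_dlE ?(ltnW kN) //=.
have := p_neq0 (ltnW (ltnW kN)); have := p_neq0 (ltnW kN).
have := atom_kappa_neq0 (ltnW kN).
set y := (three_term _ _).2; set x := a k * _ - _.
move: (kappa k.+1) (p k) (p k.+1) => K q r K0 r0 q0; congr pair.
rewrite scalerBr !scalerA scalerBr !scalerA addrCA [in X in _ + X]addrC.
have -> : (K * r * q)^-1 * (K * q) = r^-1 by field; rewrite ?K0 ?r0 ?q0.
have -> : (K * r * q)^-1 * (K * r) = q^-1 by field; rewrite ?K0 ?r0 ?q0.
by rewrite addrC; apply/eqP; rewrite -subr_eq0; apply/eqP; rewrite -!mul_polyC; ring.
Qed.

Lemma stieltjes_even_three_term init k : (k < N)%N ->
  (stp init k).2 = (p k)^-1 *: (three_term init k).2.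
Proof. by move=> kN; rewrite stieltjes_pairE. Qed.

(** This includes the index 2 N - 1, since y_(2k+1) does not involve l^A_(k+1). *)
Lemma stieltjes_odd_three_term init k : (k < N)%N ->
  (stp init k.+1).1 =
  kappa k.+1 *: (p k *: (three_term init k.+1).2 - p k.+1 *: (three_term init k).2).
Proof.
by move=> kN; rewrite stieltjes_oddS ?stieltjes_pairE // /pairE pmS.
Qed.

End ThreeTerm.

(** * Formal power series and the Toeplitz-Hessenberg reciprocal *)

Section Convolution.
Variable R : fieldType.
Implicit Types (u v w g : nat -> R) (p q : {poly R}).

(** Formal power series are represented by their coefficient sequences; conv is
    their product, shift m the multiplication by x^m, and series1 the series 1. *)
Definition conv u v n : R := \sum_(i < n.+1) u i * v (n - i)%N.
Definition shift m u n : R := if (n < m)%N then 0 else u (n - m)%N.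
Definition series1 (n : nat) : R := (n == 0)%:R.

(** A coefficient of a product only depends on the coefficients of lower index,
    so identities between products of series reduce to polynomials. *)
Lemma conv_poly u v p q n :
  (forall i, (i <= n)%N -> p`_i = u i) -> (forall i, (i <= n)%N -> q`_i = v i) ->
  (p * q)`_n = conv u v n.
Proof.
move=> pu qv; rewrite coefM; apply: eq_bigr => i _.
by rewrite pu ?qv ?leq_subr // -ltnS.
Qed.

Let trunc n u : {poly R} := \poly_(i < n.+1) u i.
Let coef_trunc n u i : (i <= n)%N -> (trunc n u)`_i = u i.
Proof. by rewrite coef_poly ltnS => ->. Qed.
Let conv_trunc n m u v : (m <= n)%N -> (trunc n u * trunc n v)`_m = conv u v m.
Proof. by move=> mn; apply: conv_poly => i im; rewrite coef_trunc ?(leq_trans im). Qed.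

Lemma convC u v : conv u v = conv v u.
Proof. by apply/funext => n; rewrite -!(@conv_trunc n) // mulrC. Qed.

Lemma convA u v w : conv u (conv v w) = conv (conv u v) w.
Proof.
apply/funext => n; transitivity ((trunc n u * (trunc n v * trunc n w))`_n).
  symmetry; apply: conv_poly => i lein; [exact: coef_trunc | exact: conv_trunc].
by rewrite mulrA; apply: conv_poly => i lein; [exact: conv_trunc | exact: coef_trunc].
Qed.

Lemma conv_series1 u : conv series1 u = u.
Proof.
apply/funext => n; rewrite /conv big_ord_recl /= mul1r subn0 big1 ?addr0 // => i _.
by rewrite mul0r.
Qed.

Lemma conv_shift m u v : conv (shift m u) v = shift m (conv u v).
Proof.
apply/funext => n.
transitivity (('X^m * (trunc n u * trunc n v))`_n).
  rewrite mulrA; symmetry; apply: conv_poly => i lein; last exact: coef_trunc.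
  rewrite coefXnM /shift; case: ltnP => // mi.
  by rewrite coef_trunc // (leq_trans (leq_subr _ _)).
rewrite coefXnM /shift; case: ltnP => // mn.
by rewrite conv_trunc ?leq_subr.
Qed.

Lemma shift_shift m n u : shift m (shift n u) = shift (m + n) u.
Proof.
apply/funext => i; rewrite /shift; case: (ltnP i m) => im.
  by rewrite ltn_addr.
by rewrite ltn_subLR // subnDA.
Qed.

(** The product of series of orders at least m and n has order at least m + n,
    and its coefficient there is the product of the two leading ones. *)
Lemma conv_low m n u v : (forall i, (i < m)%N -> u i = 0) ->
  (forall i, (i < n)%N -> v i = 0) ->
  (forall i, (i < m + n)%N -> conv u v i = 0) /\ conv u v (m + n)%N = u m * v n.
Proof.
move=> um vn; split=> [i imn|].
  apply: big1 => j _; case: (ltnP j m) => jm; first by rewrite um ?mul0r.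
  by rewrite [v _]vn ?mulr0 //; have := ltn_ord j; lia.
have mlt : (m < (m + n).+1)%N by rewrite ltnS leq_addr.
rewrite /conv (bigD1 (Ordinal mlt)) //= addKn big1 ?addr0 // => j jm.
case: (ltnP j m) => jm'; first by rewrite um ?mul0r.
rewrite [v _]vn ?mulr0 //.
have : nat_of_ord j != m by apply: contraNneq jm => e; apply/eqP/val_inj.
have := ltn_ord j; lia.
Qed.

Definition toeplitz_hessenberg g m : R :=
  \det (\matrix_(p < m, q < m) if (q <= p.+1)%N then g (p.+1 - q)%N else 0).

(** The coefficients of g(0) / g, given by Toeplitz-Hessenberg determinants. *)
Definition reciprocal g m : R := (-1) ^+ m / g 0 ^+ m * toeplitz_hessenberg g m.

(** The first n + 1 coefficients of g(0) / g, computed recursively. *)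
Fixpoint reciprocal_seq g n : seq R :=
  if n is n'.+1 then
    let s := reciprocal_seq g n' in
    rcons s (- (\sum_(i < n) g (n - i)%N * s`_i) / g 0)
  else [:: 1].

Lemma size_reciprocal_seq g n : size (reciprocal_seq g n) = n.+1.
Proof. by elim: n => //= n IHn; rewrite size_rcons IHn. Qed.

Lemma nth_reciprocal_seq g n i : (i <= n)%N ->
  (reciprocal_seq g n)`_i = (reciprocal_seq g i)`_i.
Proof.
elim: n => [|n IHn]; first by rewrite leqn0 => /eqP->.
rewrite leq_eqVlt => /predU1P[->//|]; rewrite ltnS => lein.
by rewrite /= nth_rcons size_reciprocal_seq ltnS lein IHn.
Qed.

Lemma conv_reciprocal_seq g : g 0 != 0 ->
  conv g (fun n => (reciprocal_seq g n)`_n) = fun n => g 0 * series1 n.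
Proof.
move=> g0; apply/funext => -[|n].
  by rewrite /conv big_ord_recl big_ord0 addr0 subnn.
rewrite convC /conv big_ord_recr /= subnn nth_rcons size_reciprocal_seq ltnn eqxx.
rewrite divfK // mulr0 -[X in _ - X]/(\sum_(i < n.+1) _) -sumrB big1 // => i _.
have lein : (i <= n)%N by rewrite -ltnS.
by rewrite (nth_reciprocal_seq g lein) mulrC subrr.
Qed.

(** Cramer's rule for the lower triangular Toeplitz matrix of g: the minor that
    gives the last unknown is the Hessenberg determinant. *)
Lemma reciprocal_seqE g n : g 0 != 0 -> (reciprocal_seq g n)`_n = reciprocal g n.
Proof.
move=> g0; pose h n := (reciprocal_seq g n)`_n; rewrite -/(h n).
pose T : 'M[R]_n.+1 := \matrix_(p, q) if (q <= p)%N then g (p - q)%N else 0.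
have Th : T *m (\col_p h p) = \col_p (g 0 * series1 p).
  apply/matrixP => p z; rewrite !mxE -[RHS](congr1 (@^~ (val p)) (conv_reciprocal_seq g0)).
  rewrite convC /conv (big_ord_widen n.+1 (fun i => h i * g (p - i)%N) (ltn_ord p)).
  rewrite [RHS]big_mkcond; apply: eq_bigr => j _; rewrite !mxE ltnS.
  by case: leqP; rewrite ?mul0r // mulrC.
have detT : \det T = g 0 ^+ n.+1.
  rewrite det_trig; last by apply/is_trig_mxP => i j ij; rewrite mxE leqNgt ij.
  rewrite (eq_bigr (fun=> g 0)) ?prodr_const ?card_ord // => i _.
  by rewrite mxE leqnn subnn.
have := congr1 (fun M => (\adj T *m M) ord_max 0) Th.
rewrite mulmxA mul_adj_mx mul_scalar_mx detT !mxE big_ord_recl big1 ?addr0; last first.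
  by move=> i _; rewrite !mxE /series1 /= mulr0 mulr0.
rewrite !mxE /series1 eqxx mulr1 /cofactor add0n => E.
apply: (mulfI (expf_neq0 n.+1 g0)); rewrite E mulrC exprS -mulrA; congr (_ * _).
rewrite /reciprocal mulrCA -mulrA; congr (_ * _).
rewrite mulrA mulVf ?mul1r ?expf_neq0 //.
congr (\det _); apply/matrixP => p q; rewrite !mxE /=.
have -> : bump n q = q by rewrite /bump leqNgt ltn_ord.
by rewrite /bump /= add1n.
Qed.

Lemma conv_reciprocal g : g 0 != 0 ->
  conv g (reciprocal g) = fun n => g 0 * series1 n.
Proof.
move=> g0; rewrite -conv_reciprocal_seq //; congr conv.
by apply/funext => n; rewrite reciprocal_seqE.
Qed.

End Convolution.

(** * Hankel determinants and orthogonality *)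

Section HankelKernel.
Variables (R : realType) (c : nat -> R).
Implicit Types p q : {poly R}.

(** The linear functional with t^i |-> c_i. *)
Definition moment p : R := \sum_(i < size p) p`_i * c i.

Lemma moment_wide n p : (size p <= n)%N -> moment p = \sum_(i < n) p`_i * c i.
Proof.
move=> pn; rewrite /moment (big_ord_widen n (fun i => p`_i * c i)) // big_mkcond.
by apply: eq_bigr => i _; case: ltnP => // ?; rewrite nth_default ?mul0r.
Qed.

Lemma moment_is_scalar : scalar moment.
Proof.
move=> a p q; pose n := maxn (size p) (size q).
have pn : (size p <= n)%N by rewrite leq_maxl.
have qn : (size q <= n)%N by rewrite leq_maxr.
rewrite !(@moment_wide n) //; last first.
  by rewrite (leq_trans (size_polyD _ _)) // geq_max (leq_trans (size_scale_leq _ _)).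
rewrite mulr_sumr -big_split /=; apply: eq_bigr => i _.
by rewrite coefD coefZ mulrDl mulrA.
Qed.
HB.instance Definition _ :=
  GRing.isLinear.Build R {poly R} R *%R moment moment_is_scalar.

Lemma momentB p q : moment (p - q) = moment p - moment q.
Proof. exact: linearB. Qed.

Lemma momentZ a p : moment (a *: p) = a * moment p.
Proof. exact: linearZ. Qed.

Lemma moment_Xn n : moment 'X^n = c n.
Proof.
rewrite /moment size_polyXn big_ord_recr /= coefXn eqxx mul1r big1 ?add0r // => i _.
by rewrite coefXn (ltn_eqF (ltn_ord i)) mul0r.
Qed.

Lemma moment_mul m i p q : (size q <= m)%N ->
  moment ('X^i * (q * p)) = \sum_(j < m) q`_j * moment ('X^(i + j) * p).
Proof.
move=> qm; have -> : 'X^i * (q * p) = \sum_(j < m) q`_j *: ('X^(i + j) * p).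
  rewrite mulrCA -[in LHS](coefK q) poly_def mulr_suml.
  rewrite (big_ord_widen m (fun j => q`_j *: 'X^j * ('X^i * p))) // big_mkcond.
  apply: eq_bigr => j _; case: ltnP => [_|uj]; last by rewrite nth_default ?scale0r.
  by rewrite -scalerAl mulrA -exprD addnC.
by rewrite linear_sum; apply: eq_bigr => j _; rewrite linearZ.
Qed.

Lemma moment_mulXn n i p : (size p <= n)%N ->
  moment ('X^i * p) = \sum_(q < n) p`_q * c (i + q)%N.
Proof.
move=> pn; rewrite -[in LHS](mulr1 p) (moment_mul _ _ pn); apply: eq_bigr => q _.
by rewrite mulr1 moment_Xn.
Qed.

(** A kernel vector of the Hankel matrix is a polynomial of degree less than m
    that is orthogonal to all polynomials of degree less than m. *)
Lemma hankel_det_eq0P m : reflect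
  (exists p, [/\ p != 0, (size p <= m)%N & forall i, (i < m)%N -> moment ('X^i * p) = 0])
  (hankel_det c m == 0).
Proof.
apply: (iffP det0P) => [[v v0 vH]|[p [p0 pm pH]]].
  exists (rVpoly v); split; last 1 first.
  - move=> i im; rewrite (@moment_mulXn m) ?size_poly //.
    have := congr1 (fun M : 'rV_m => M 0 (Ordinal im)) vH; rewrite !mxE => vHi; rewrite -[RHS]vHi.
    by apply: eq_bigr => q _; rewrite mxE coef_rVpoly_ord addnC.
  - by apply: contraNneq v0 => v0; rewrite -[v]rVpolyK v0 linear0.
  - exact: size_poly.
exists (poly_rV p).
  by apply: contraNneq p0 => p0; rewrite -(poly_rV_K pm) p0 linear0.
apply/matrixP => z i; rewrite !mxE -[RHS](pH i) // (@moment_mulXn m) //.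
by apply: eq_bigr => q _; rewrite !mxE addnC.
Qed.

(** If the orthogonal polynomial p of a normal index n is orthogonal to
    1, ..., t^(e-1) but not to t^e, then the next normal index is e + 1. *)
Lemma hankel_gap n e p : p \is monic -> size p = n.+1 -> hankel_det c n != 0 ->
    (n <= e)%N -> (forall i, (i < e)%N -> moment ('X^i * p) = 0) ->
    moment ('X^e * p) != 0 ->
  (forall m, (n < m <= e)%N -> hankel_det c m = 0) /\ hankel_det c e.+1 != 0.
Proof.
move=> pmon psz Dn ne pe pe0; split=> [m /andP[nm me]|].
  apply/eqP/hankel_det_eq0P; exists p; split; rewrite ?monic_neq0 ?psz //.
  by move=> i im; apply: pe; apply: leq_trans me.
apply/negP => /hankel_det_eq0P[w [w0 wsz wH]].
(* Divide a kernel element w by p.  The remainder is in the kernel for n, hence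
   zero; testing u p against t^(e - deg u) then isolates the leading
   coefficient of u. *)
set u := w %/ p; set r := w %% p; have wE : w = u * p + r by rewrite -divp_eq.
have rsz : (size r <= n)%N by rewrite -ltnS -psz ltn_modpN0 ?monic_neq0.
have usz : (size u <= e.+1 - n)%N by rewrite size_divp ?monic_neq0 // psz leq_sub.
have r0 : r = 0.
  apply/eqP; apply: contraNT Dn => r0; apply/hankel_det_eq0P; exists r; split => // i im.
  have := wH i (leq_trans im (leq_trans ne (leqnSn e))); rewrite wE mulrDr linearD /=.
  rewrite (moment_mul _ _ usz) big1 ?add0r // => j _.
  by rewrite pe ?mulr0 //; have := ltn_ord j; lia.
move: wE; rewrite r0 addr0 => wE.
have u0 : u != 0 by apply: contraNneq w0 => u0; rewrite wE u0 mul0r.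
have [d su] : exists d, size u = d.+1.
  by exists (size u).-1; rewrite prednK // lt0n size_poly_eq0.
have de : (d <= e)%N by move: usz; rewrite su; lia.
have := wH (e - d)%N; rewrite wE (@moment_mul d.+1) ?su // big_ord_recr /= subnK //.
rewrite big1 ?add0r => [H|j _]; last first.
  by rewrite pe ?mulr0 //; have := ltn_ord j; lia.
move/eqP: (H (leq_ltn_trans (leq_subr _ _) (ltnSn e))).
rewrite mulf_eq0 (negPf pe0) orbF => /eqP ud.
by move/eqP: u0; apply; apply/eqP; rewrite -lead_coef_eq0 /lead_coef su ud.
Qed.

End HankelKernel.

Section NormalIndices.
Variables (R : realType) (c : nat -> R) (nn : nat).
Local Notation N := (Nn c nn).
Local Notation nx := (nidx c nn).

Let idx := 0%N :: normal_indices c nn.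
Let idx_sorted : sorted ltn idx.
Proof.
rewrite /= /idx path_min_sorted; last first.
  by apply/allP => i; rewrite mem_filter mem_iota => /andP[_ /andP[]].
by apply: sorted_filter; [exact: ltn_trans | exact: iota_ltn_sorted].
Qed.
Let size_idx : size idx = N.+1. Proof. by []. Qed.

Lemma nidx_ltn i j : (i < j)%N -> (j <= N)%N -> (nx i < nx j)%N.
Proof.
move=> ij jN; apply: (sorted_ltn_nth ltn_trans 0%N idx_sorted) => //.
  by rewrite inE size_idx ltnS (leq_trans (ltnW ij)).
Qed.

Lemma nidx_leq i j : (i <= j)%N -> (j <= N)%N -> (nx i <= nx j)%N.
Proof. by rewrite leq_eqVlt => /predU1P[->//|ij jN]; rewrite ltnW ?nidx_ltn. Qed.

Lemma nidx_le k : (k <= N)%N -> (nx k <= nn)%N.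
Proof.
case: k => // k kN; have : nx k.+1 \in normal_indices c nn by apply: mem_nth.
by rewrite mem_filter mem_iota add1n ltnS => /andP[_ /andP[]].
Qed.

Lemma hankel_nidx k : (k <= N)%N -> hankel_det c (nx k) != 0.
Proof.
case: k => [_|k kN]; first by rewrite /hankel_det det_mx00 oner_eq0.
have : nx k.+1 \in normal_indices c nn by apply: mem_nth.
by rewrite mem_filter => /andP[].
Qed.

Lemma hankel_nidxP m : (0 < m <= nn)%N -> hankel_det c m != 0 ->
  exists2 j, (j <= N)%N & nx j = m.
Proof.
move=> mn Dm; have mi : m \in normal_indices c nn.
  by rewrite mem_filter Dm mem_iota add1n ltnS.
exists (index m (normal_indices c nn)).+1; first by rewrite /Nn index_mem.
by rewrite /nidx /= nth_index.
Qed.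

End NormalIndices.

(** * The atoms as parts of a reciprocal series *)

Section AtomPolynomial.
Variables (R : realType) (c : nat -> R) (nn : nat) (t : R).
Local Notation N := (Nn c nn).
Local Notation a := (atom_a c nn t).
Local Notation b := (atom_b c nn).
Local Notation phi := (cseq c nn).
Local Notation nu := (nu c nn).

(** The series phi_k with its first nu_(k+1) - 1 terms, which vanish, removed. *)
Definition leading_series k i : R := phi k ((nu k.+1).-1 + i)%N.
Local Notation h k := (reciprocal (leading_series k)).

(** The polynomial part of z^nu h(1/z), where nu = nu_(k+1) and h is the
    reciprocal of the leading series; it does not depend on t. *)
Definition polynomial_part k : {poly R} := \poly_(q < (nu k.+1).+1) h k (nu k.+1 - q)%N.

Lemma leading_series0 k : leading_series k 0 = b k.
Proof. by rewrite /leading_series addn0. Qed.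

(** The recursion for c^(k+1) selects, up to sign, the terms of the reciprocal
    that are not in the polynomial part. *)
Lemma cseqS k i : (0 < nu k.+1)%N -> phi k.+1 i = - h k (i + nu k.+1).+1.
Proof.
move=> nu0; rewrite /reciprocal leading_series0 [(-1) ^+ _]exprS mulN1r !mulNr opprK /=.
congr (_ * _); congr (\det _); apply/matrixP => p q; rewrite !mxE.
by case: ifP => // qp; rewrite /leading_series; congr (phi k _); lia.
Qed.

Lemma reciprocal0 k : h k 0 = 1.
Proof. by rewrite /reciprocal /toeplitz_hessenberg det_mx00 !expr0 divr1 mulr1. Qed.

Variable k : nat.
Hypothesis kN : (k < N)%N.
Hypothesis nu_gt0 : (0 < nu k.+1)%N.
Hypothesis phi_low : forall i, (i < (nu k.+1).-1)%N -> phi k i = 0.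
Hypothesis b_neq0 : b k != 0.
Local Notation v := (nu k.+1).

Lemma conv_leading_series :
  conv (leading_series k) (h k) = fun n => b k * series1 R n.
Proof. by rewrite conv_reciprocal ?leading_series0. Qed.

Lemma shift_leading_series : shift 1 (phi k) = shift v (leading_series k).
Proof.
(* Not needed; otherwise lia would make the lemma depend on them. *)
clear kN b_neq0.
apply/funext => i; rewrite /shift; case: (ltnP i v) => iv.
  by case: ltnP => // i0; apply: phi_low; lia.
have -> : (i < 1)%N = false by lia.
by rewrite /leading_series; congr (phi k _); lia.
Qed.

Lemma hankel_leading : hankel_det (phi k) v != 0.
Proof.
have [||||_] := @hankel_gap R (phi k) 0 v.-1 1 (monic1 _) (size_poly1 _); last by rewrite prednK.
- by rewrite /hankel_det det_mx00 oner_eq0.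
- by [].
- by move=> i iv; rewrite mulr1 moment_Xn phi_low.
- by rewrite mulr1 moment_Xn.
Qed.

(** The substituted entry t is the one of index 2 nu_(k+1) - 1 for k = N - 1. *)
Lemma centry_eq i : (i < v.*2.-1)%N || (k != N.-1) && (i <= v.*2.-1)%N ->
  centry c nn t k i = phi k i.
Proof.
rewrite /centry; case: (eqVneq k N.-1) => //= kN1; rewrite orbF => iv.
have -> : N = k.+1 by move: kN; lia.
by rewrite ltn_eqF.
Qed.

(* The real matrix with the rows of atom_a, except for the last one, which is
   irrelevant for the cofactors along it. *)
Let M : 'M[R]_v.+1 := \matrix_(p, q) if (p < v)%N then centry c nn t k (p + q) else 0.

Let C j := cofactor M ord_max (inord j).

Let atom_aE : a k = (hankel_det (phi k) v)^-1 *: \poly_(j < v.+1) C j.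
Proof.
rewrite /atom_a; congr (_ *: _); rewrite (expand_det_row _ ord_max) poly_def.
apply: eq_bigr => j _; rewrite mxE /= ltnn mulrC -mul_polyC /C inord_val.
congr (_ * _); rewrite /cofactor polyCM rmorphXn rmorphN1; congr (_ * _).
rewrite -det_map_mx; congr (\det _); apply/matrixP => p q; rewrite !mxE.
by rewrite lift_max ltn_ord.
Qed.

Lemma coef_atom_a_last : (a k)`_v = 1.
Proof.
rewrite atom_aE coefZ coef_poly ltnSn /C (_ : inord v = ord_max); last first.
  by apply/val_inj; rewrite /= inordK.
rewrite /cofactor exprD -exprMn mulrNN mul1r expr1n mul1r.
rewrite (_ : \det _ = hankel_det (phi k) v) ?mulVf ?hankel_leading //.
congr (\det _); apply/matrixP => p q; rewrite !mxE !lift_max ltn_ord centry_eq //.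
have key x y : (x < v)%N -> (y < v)%N -> (x + y < v.*2.-1)%N by lia.
by apply/orP; left; apply: key; exact: ltn_ord.
Qed.

(* Expansion of a determinant with two equal rows. *)
Let atom_a_orth p : (p < v)%N ->
  \sum_(q < v.+1) centry c nn t k (p + q) * (a k)`_q = 0.
Proof.
move=> pv; have pv' : (p < v.+1)%N by lia.
transitivity ((hankel_det (phi k) v)^-1 * (M *m \adj M) (Ordinal pv') ord_max).
  rewrite !mxE mulr_sumr; apply: eq_bigr => q _.
  rewrite !mxE /= pv atom_aE coefZ coef_poly ltn_ord /C inord_val.
  by rewrite mulrCA.
rewrite mul_mx_adj mxE -val_eqE /= (ltn_eqF pv) mulr0n mulr0 //.
Qed.

(* The row i - 1 of the orthogonality relations, read as a coefficient of a
   product of series.  The row nu - 1 is the one that involves t. *)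
Let conv_atom i : (0 < i <= v)%N -> (i < v)%N || (k != N.-1) ->
  conv (leading_series k) (fun j => (a k)`_(v - j)) i = 0.
Proof.
move=> /andP[i0 iv] ik; rewrite convC /conv -[RHS](@atom_a_orth i.-1); last by lia.
rewrite [RHS](reindex_inj rev_ord_inj) /=.
rewrite (big_ord_widen v.+1 (fun j => (a k)`_(v - j) * leading_series k (i - j))) //.
rewrite big_mkcond; apply: eq_bigr => j _; rewrite subSS mulrC.
have jv := ltn_ord j; rewrite centry_eq; last by move: ik; case: (k != _) => /=; lia.
case: ltnP => ji; first by congr (_ * _); rewrite /leading_series; congr (phi k _); lia.
by rewrite phi_low ?mul0r //; lia.
Qed.

Let coef_atom_a i : (i <= v)%N -> (i < v)%N || (k != N.-1) -> (a k)`_(v - i) = h k i.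
Proof.
elim/ltn_ind: i => -[_ _ _|i IHi iv ik]; first by rewrite subn0 coef_atom_a_last reciprocal0.
have E1 := conv_atom (i := i.+1) iv ik.
have := congr1 (@^~ i.+1) conv_leading_series; rewrite /= mulr0 -[RHS]E1.
rewrite ![conv (leading_series k) _]convC /conv !(big_ord_recr i.+1) /= subnn.
rewrite leading_series0 (eq_bigr (fun j : 'I_i.+1 => (a k)`_(v - j) *
   leading_series k (i.+1 - j))) => [/addrI/(mulIf b_neq0)//|j _].
have ji := ltn_ord j; rewrite IHi //; first by lia.
by have -> : (j < v)%N by lia.
Qed.

(** The value t only affects the constant term of a_(N-1). *)
Lemma atom_aE_polynomial_part :
  exists2 e : R, a k = polynomial_part k + e%:P & k != N.-1 -> e = 0.
Proof.
exists ((a k)`_0 - h k v); last first.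
  by move=> kN1; rewrite -[in (a k)`_0](subnn v) coef_atom_a ?subrr ?kN1 ?orbT.
apply/polyP => q; rewrite coefD coefC coef_poly ltnS.
case: leqP => qv; last first.
  rewrite atom_aE coefZ coef_poly ltnS leqNgt qv /= mulr0 add0r.
  by case: q qv.
case: q qv => [|q] qv /=; first by rewrite subn0 addrC subrK.
by rewrite addr0 -coef_atom_a ?subKn //; lia.
Qed.

End AtomPolynomial.

(** * The formal expansions of the remainders *)

Section FormalConvergents.
Variables (R : realType) (c : nat -> R) (nn : nat) (t : R).
Local Notation N := (Nn c nn).
Local Notation nx := (nidx c nn).
Local Notation a := (atom_a c nn t).
Local Notation b := (atom_b c nn).
Local Notation phi := (cseq c nn).
Local Notation nu := (nu c nn).
Local Notation P := (three_term c nn t (0, 1)).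

(** The series rho_(k-1), where rho_(-1) = 1 and rho_k = x phi_k rho_(k-1).  It is
    minus the expansion in x = 1/z of f P_(n_(k-1)) - Q_(n_(k-1)), for k <= N. *)
Fixpoint residual (k : nat) : nat -> R :=
  if k is k'.+1 then conv (shift 1 (phi k')) (residual k') else series1 R.

(** The coefficients of x^nu a(1/x), where a is the polynomial part and
    nu = nu_(k+1); zero beyond x^nu, where the truncated subtraction would
    otherwise repeat the constant term of a. *)
Definition reversed_part k i : R := (polynomial_part c nn k)`_(nu k.+1 - i) *+ (i <= nu k.+1).

Let nuE k : (k < N)%N -> (nx k + nu k.+1)%N = nx k.+1.
Proof. by move=> kN; rewrite /Defs.nu /= subnKC // nidx_leq. Qed.

Let nu_gt0 k : (k < N)%N -> (0 < nu k.+1)%N.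
Proof. by move=> kN; rewrite /Defs.nu /= subn_gt0 nidx_ltn. Qed.

(** The recurrence R_(k+1) = a_k R_k - b_k R_(k-1), multiplied by x^nu. *)
Lemma residual_recurrence k : (0 < nu k.+1)%N ->
  (forall i, (i < (nu k.+1).-1)%N -> phi k i = 0) -> b k != 0 ->
  forall i, conv (reversed_part k) (residual k.+1) i
              - b k * shift (nu k.+1) (residual k) i
            = shift (nu k.+1) (residual k.+2) i.
Proof.
move=> nu0 low b0 i; set v := nu k.+1 in nu0 low *.
pose h := reciprocal (leading_series c nn k).
have hE : conv h (residual k.+1) = fun i => b k * shift v (residual k) i.
  rewrite /= shift_leading_series //  conv_shift [conv h _]convC conv_shift.
  rewrite [conv (conv _ _) h]convC convA.
  rewrite [conv h _]convC conv_leading_series //; apply/funext => j.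
  rewrite /shift; case: ltnP => _; first by rewrite mulr0.
  rewrite -[residual k in RHS]conv_series1 /conv mulr_sumr.
  by apply: eq_bigr => q _; rewrite mulrA.
rewrite -[X in _ - X](congr1 (@^~ i) hE) -[residual k.+2]/(conv _ (residual k.+1)).
rewrite -conv_shift shift_shift /conv -sumrB; apply: eq_bigr => j _.
rewrite -mulrBl; congr (_ * _).
rewrite /reversed_part /polynomial_part coef_poly -/v -/h /shift addn1 !ltnS leq_subr.
case: leqP => jv; first by rewrite subKn // mulr1n subrr.
rewrite mulr0n sub0r cseqS // -/v -/h; congr (- h _); lia.
Qed.

(** P_(n_k) is monic of degree n_k, the coefficients of rho_k and rho_(k-1) are
    the moments of P_(n_k) and P_(n_(k-1)), and rho_(k-1) has order n_k. *)
Definition formal_invariant k :=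
  [/\ (P k).2 \is monic /\ size (P k).2 = (nx k).+1,
      (size (P k).1 <= nx k)%N,
      forall i, residual k.+1 i.+1 = moment c ('X^i * (P k).2),
      forall i, residual k i.+1 = moment c ('X^i * (P k).1)
    & (forall i, (i < nx k)%N -> residual k i = 0) /\ residual k (nx k) != 0].

Lemma formal_invariant0 : formal_invariant 0.
Proof.
split => /=; rewrite ?size_poly0 //.
- by rewrite monic1 size_poly1.
- by move=> i; rewrite convC conv_series1 mulr1 moment_Xn /shift subn1.
- by move=> i; rewrite mulr0 linear0.
- by split=> //; rewrite /series1 /nidx /= oner_eq0.
Qed.

Lemma residual_order k : (k < N)%N -> formal_invariant k ->
  [/\ forall i, (i < nx k.+1)%N -> residual k.+1 i = 0,
      residual k.+1 (nx k.+1) != 0,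
      forall i, (i < (nu k.+1).-1)%N -> phi k i = 0
    & b k != 0].
Proof.
move=> kN [[Pm Psz] _ rP _ [r0 rn]].
have low1 i : (i < 1)%N -> shift 1 (phi k) i = 0 by rewrite /shift => ->.
have mom0 i : (i < nx k)%N -> moment c ('X^i * (P k).2) = 0.
  by move=> ik; rewrite -rP; apply: (conv_low low1 r0).1; rewrite add1n ltnS.
(* P_(n_k) is not orthogonal to all the powers below n_(k+1), since it would then
   be in the kernel of a regular Hankel matrix. *)
have [e [en momn]] : exists e, (e < nx k.+1)%N /\ moment c ('X^e * (P k).2) != 0.
  apply: contrapT => /forallNP H; have /negP := hankel_nidx (k := k.+1) kN; apply.
  apply/hankel_det_eq0P; exists (P k).2; split; first exact: monic_neq0.
    by rewrite Psz nidx_ltn.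
  by move=> i ik; apply/eqP; apply: contraT => ?; case: (H i).
have [{en momn}e /andP[en momn] emin] := ex_minnP (ex_intro
   (fun e => (e < nx k.+1)%N && (moment c ('X^e * (P k).2) != 0)) e (introT andP (conj en momn))).
have emin0 i : (i < e)%N -> moment c ('X^i * (P k).2) = 0.
  move=> ie; apply/eqP; apply: contraT => mi.
  by have := emin i; rewrite (ltn_trans ie en) mi leqNgt ie => /(_ isT).
have ne : (nx k <= e)%N.
  by rewrite leqNgt; apply: contraNN momn => /mom0 ->.
have [gap De] := hankel_gap Pm Psz (hankel_nidx (ltnW kN)) ne emin0 momn.
have eE : e.+1 = nx k.+1.
  apply/eqP; rewrite eqn_leq en leqNgt; apply/negP => eN.
  have enn : (0 < e.+1 <= nn)%N.
    by rewrite /= (leq_trans en) // nidx_le.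
  have [j jN jE] := hankel_nidxP enn De.
  case: (leqP j k) => jk; first by have := nidx_leq jk (ltnW kN); rewrite jE; lia.
  by have := nidx_leq jk jN; rewrite jE; lia.
have low i : (i < nx k.+1)%N -> residual k.+1 i = 0.
  case: i => [|i] ik; first by apply: (conv_low low1 r0).1.
  by rewrite rP emin0 // -ltnS eE.
have high : residual k.+1 (nx k.+1) != 0 by rewrite -eE rP.
have step i : (forall j, (j < i)%N -> phi k j = 0) ->
    residual k.+1 (i.+1 + nx k) = phi k i * residual k (nx k).
  move=> phij; have lowi j : (j < i.+1)%N -> shift 1 (phi k) j = 0.
    by move=> ji; rewrite /shift; case: ltnP => // j0; rewrite phij //; lia.
  by have [_ E] := conv_low lowi r0; rewrite [LHS]E /shift /= subn1.
have phi0 i : (i < (nu k.+1).-1)%N -> phi k i = 0.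
  elim/ltn_ind: i => i IHi ik.
  have := step i (fun j ji => IHi j ji (ltn_trans ji ik)).
  rewrite low; last by rewrite -nuE //; lia.
  by move/esym/eqP; rewrite mulf_eq0 (negPf rn) orbF => /eqP.
split=> //; apply: contraNneq high => b0.
have := step _ phi0; rewrite prednK ?nu_gt0 // addnC nuE // => ->.
by rewrite -[phi k _]/(b k) b0 mul0r.
Qed.

Lemma formal_invariantS k : (k.+1 < N)%N -> formal_invariant k ->
  formal_invariant k.+1.
Proof.
move=> kN inv; have kN' := ltnW kN; have [[Pm Psz] Qsz rP rQ [r0 rn]] := inv.
have [low high phi0 b0] := residual_order kN' inv.
have nu0 := nu_gt0 kN'.
have [e aE e0] := atom_aE_polynomial_part t kN' nu0 phi0 b0.
have {e e0}aE : a k = polynomial_part c nn k.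
  by rewrite aE e0 ?addr0 //; lia.
have asz : size (a k) = (nu k.+1).+1.
  by rewrite aE size_poly_eq // subnn reciprocal0 oner_eq0.
have am : a k \is monic.
  by apply/monicP; rewrite /lead_coef asz /= coef_atom_a_last.
have apsz : size (a k * (P k).2) = (nx k.+1).+1.
  by rewrite size_monicM ?monic_neq0 // asz Psz -nuE //; lia.
have bsz : (size (- (b k *: (P k).1))%R < size (a k * (P k).2)%R)%N.
  rewrite size_polyN apsz ltnS (leq_trans (size_scale_leq _ _)) //.
  by rewrite (leq_trans Qsz) // nidx_leq.
split=> //=.
- split; last by rewrite size_polyDl // apsz.
  by rewrite monicE lead_coefDl // -monicE monicMl.
- by rewrite Psz nidx_ltn.
move=> i; have := residual_recurrence nu0 phi0 b0 (nu k.+1 + i.+1).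
rewrite /shift ltnNge leq_addr /= addKn => <-.
rewrite mulrBr momentB -scalerAr momentZ -rQ; congr (_ - _).
rewrite (@moment_mul _ _ (nu k.+1).+1) ?asz // /conv.
rewrite [RHS](reindex_inj rev_ord_inj) /=.
rewrite (big_ord_widen (nu k.+1 + i.+1).+1 (fun j => (a k)`_(nu k.+1 - j) * moment c ('X^(i + (nu k.+1 - j)) * (P k).2))); last by lia.
rewrite [RHS]big_mkcond; apply: eq_bigr => j _.
rewrite /reversed_part -aE ltnS; case: leqP => jv; last by rewrite mul0r.
by rewrite mulr1n -rP (_ : (nu k.+1 + i.+1 - j = (i + (nu k.+1 - j)).+1)%N) //; lia.
Qed.

Lemma formal_invariantP k : (k < N)%N -> formal_invariant k.
Proof.
elim: k => [_|k IHk kN]; first exact: formal_invariant0.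
by apply: formal_invariantS (IHk (ltnW kN)).
Qed.

End FormalConvergents.

(** * Limits and asymptotic expansions in Stolz domains *)

Section StolzLimits.
Variable R : realType.
Implicit Types (f g : R[i] -> R[i]) (l : R[i]) (p : {poly R}).

(** f tends to l as |z| tends to infinity in every Stolz domain. *)
Definition stolz_lim f l : Prop := forall theta, 0 < theta -> theta <= pi / 2 ->
  ((f : R[i] -> R[i]^o) @ stolz_infty theta --> (l : R[i]^o))%classic.

Lemma stolz_near_neq0 (theta : R) : \forall z \near stolz_infty theta, z != 0 :> R[i].
Proof. by exists 0 => z _ z0; rewrite -normr_gt0. Qed.

Lemma stolz_lim_eq f g l : stolz_lim g l ->
  (forall z, z != 0 -> f z = g z) -> stolz_lim f l.
Proof.
move=> gl fg theta t0 tpi; apply: cvg_trans (gl theta t0 tpi).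
apply: near_eq_cvg; apply: filterS (stolz_near_neq0 theta) => z z0 /=.
by rewrite fg.
Qed.

Lemma stolz_lim_cst l : stolz_lim (fun=> l) l.
Proof. by move=> theta _ _; apply: cvg_cst. Qed.
Arguments stolz_lim_cst : clear implicits.

Lemma stolz_limD f g l m : stolz_lim f l -> stolz_lim g m ->
  stolz_lim (fun z => f z + g z) (l + m).
Proof. by move=> fl gm theta t0 tpi; apply: cvgD (fl _ t0 tpi) (gm _ t0 tpi). Qed.

Lemma stolz_limM f g l m : stolz_lim f l -> stolz_lim g m ->
  stolz_lim (fun z => f z * g z) (l * m).
Proof.
move=> fl gm theta t0 tpi.
exact: (@cvgM _ _ _ _ (f : R[i] -> R[i]^o) (g : R[i] -> R[i]^o) l m (fl _ t0 tpi) (gm _ t0 tpi)).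
Qed.

Lemma stolz_limV f l : l != 0 -> stolz_lim f l -> stolz_lim (fun z => (f z)^-1) l^-1.
Proof.
move=> l0 fl theta t0 tpi.
exact: (@cvgV _ _ _ _ (f : R[i] -> R[i]^o) l l0 (fl _ t0 tpi)).
Qed.

Lemma stolz_lim_neq0 f l : stolz_lim f l -> l != 0 ->
  forall theta, 0 < theta -> theta <= pi / 2 ->
    \forall z \near stolz_infty theta, f z != 0.
Proof.
move=> fl l0 theta t0 tpi.
exact: (@cvgr_neq0 _ (R[i]^o : normedModType R[i]) _ _ _ f l (fl _ t0 tpi) l0).
Qed.

Lemma stolz_lim_inv : stolz_lim (fun z => z^-1) 0.
Proof.
move=> theta _ _.
apply/(@cvgr0Pnorm_le _ (R[i]^o : normedModType R[i])) => e e0.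
have eR : e = (complex.Re e)%:C by move: e0; case: e => a b; rewrite ltcE /= => /andP[/eqP-> _].
have Re0 : 0 < complex.Re e by rewrite -ltcR -eR.
have MC : ((complex.Re e)^-1)%:C = e^-1 by rewrite [in RHS]eR fmorphV.
exists (complex.Re e)^-1 => z _; rewrite MC => ez /=.
by rewrite normfV invf_ple ?posrE // ?ltW // (lt_trans _ ez) // invr_gt0.
Qed.

Lemma stolz_lim_peval p : stolz_lim (fun z => peval p z^-1) (p`_0)%:C.
Proof.
elim/poly_ind: p => [|p a IHp].
  by rewrite coef0; apply: stolz_lim_eq (stolz_lim_cst _) _ => z _; rewrite -polyC0 pevalC.
rewrite coefD coefMX coefC /= add0r -[a%:C]add0r -(mulr0 (p`_0)%:C).
apply: stolz_lim_eq (stolz_limD (stolz_limM IHp stolz_lim_inv) (stolz_lim_cst _)) _ => z _.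
by rewrite !pevalE.
Qed.
Arguments stolz_lim_peval : clear implicits.

Lemma stolz_eqoP f g m : stolz_eqo f g (fun z => (z ^+ m)^-1) <->
  stolz_lim (fun z => (f z - g z) * z ^+ m) 0.
Proof.
split=> H theta t0 tpi.
  apply/(@cvgr0Pnorm_le _ (R[i]^o : normedModType R[i])) => e e0.
  have /eqaddoP/(_ e e0) := H theta t0 tpi.
  apply: filterS2 (stolz_near_neq0 theta) => z z0 /= fg.
  by rewrite normrM -ler_pdivlMr ?normr_gt0 ?expf_neq0 // -normfV.
apply/eqaddoP => e e0.
have /(@cvgr0Pnorm_le _ (R[i]^o : normedModType R[i]))/(_ e e0) := H theta t0 tpi.
apply: filterS2 (stolz_near_neq0 theta) => z z0 /= fg.
by rewrite normfV ler_pdivlMr ?normr_gt0 ?expf_neq0 // -normrM.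
Qed.

Lemma stolz_eqo0_idP f : stolz_lim (fun z => f z / z) 0 -> stolz_eqo f (fun=> 0) id.
Proof.
move=> H theta t0 tpi; apply/eqaddoP => e e0.
have /(@cvgr0Pnorm_le _ (R[i]^o : normedModType R[i]))/(_ e e0) := H theta t0 tpi.
apply: filterS2 (stolz_near_neq0 theta) => z z0 /=.
rewrite normrM normfV ler_pdivrMr ?normr_gt0 // => fz.
by rewrite -[X in `|X|]/(f z - 0) subr0.
Qed.

Definition partial_sum (u : nat -> R) m : {poly R} := \poly_(i < m.+1) u i.

(** f(z) = - sum_(i <= m) u_i z^(-i) + o(z^(-m)). *)
Definition expansion f u m : Prop :=
  stolz_lim (fun z => (f z + peval (partial_sum u m) z^-1) * z ^+ m) 0.

Lemma stolz_lim_high p m : (forall i, (i <= m)%N -> p`_i = 0) ->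
  stolz_lim (fun z => peval p z^-1 * z ^+ m) 0.
Proof.
move=> pm; pose q : {poly R} := \poly_(i < size p) p`_(i + m.+1)%N.
have pE : p = q * 'X^(m.+1).
  apply/polyP => i; rewrite coefMXn coef_poly; case: ltnP => im; first exact: pm.
  rewrite subnK //; case: ltnP => // pi; rewrite nth_default //.
  by rewrite (leq_trans pi) ?leq_subr.
have := stolz_limM (stolz_lim_peval q) stolz_lim_inv; rewrite mulr0 => H.
apply: (stolz_lim_eq H) => z z0.
rewrite pE pevalM exprS pevalM pevalX.
have -> : peval 'X^m z^-1 = z ^- m by rewrite /peval map_polyXn hornerXn exprVn.
by rewrite -!mulrA mulVf ?mulr1 // expf_neq0.
Qed.

Lemma expansion_leq f u m k : (k <= m)%N -> expansion f u m -> expansion f u k.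
Proof.
move=> km fu; pose d := partial_sum u k - partial_sum u m.
have dk : stolz_lim (fun z => peval d z^-1 * z ^+ k) 0.
  apply: stolz_lim_high => i ik.
  by rewrite /d coefB !coef_poly !ltnS ik (leq_trans ik km) subrr.
have sk : stolz_lim (fun z => (f z + peval (partial_sum u m) z^-1) * z ^+ m *
                              z^-1 ^+ (m - k)) 0.
  have := stolz_limM fu (stolz_lim_peval 'X^(m - k)); rewrite mul0r.
  move=> H; apply: (stolz_lim_eq H) => z _; by rewrite /peval map_polyXn hornerXn.
have := stolz_limD sk dk; rewrite addr0 => H; apply: (stolz_lim_eq H) => z z0.
have -> : z ^+ m = z ^+ (m - k) * z ^+ k by rewrite -exprD subnK.
rewrite /d pevalD pevalN exprVn.
have zmk : z ^+ (m - k) != 0 by rewrite expf_neq0.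
by field.
Qed.

End StolzLimits.

Arguments stolz_lim_cst {R} l.
Arguments stolz_lim_peval {R} p.
Arguments stolz_lim_inv {R}.

(** * The problem in one variable *)

Section OneVariable.
Variables (R : realType) (c : nat -> R) (nn : nat) (t alpha : R).
Local Notation N := (Nn c nn).
Local Notation nx := (nidx c nn).
Local Notation a := (atom_a c nn t).
Local Notation b := (atom_b c nn).
Local Notation phi := (cseq c nn).
Local Notation nu := (nu c nn).
Local Notation P := (three_term c nn t (0, 1)).
Local Notation Q := (three_term c nn t (1, 0)).
Local Notation residual := (residual c nn).

Lemma peval_polynomial_part k z : z != 0 ->
  peval (polynomial_part c nn k) z =
  z ^+ nu k.+1 * peval (\poly_(j < (nu k.+1).+1) reversed_part c nn k j) z^-1.
Proof.
move=> z0; rewrite /polynomial_part !poly_def /peval !rmorph_sum !horner_sum mulr_sumr.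
rewrite [RHS](reindex_inj rev_ord_inj) /=; apply: eq_bigr => j _.
rewrite !map_polyZ !hornerZ !map_polyXn !hornerXn mulrCA subSS.
have jv : (j <= nu k.+1)%N by rewrite -ltnS.
rewrite /reversed_part leq_subr mulr1n /polynomial_part coef_poly subKn // ltn_ord.
congr (_ * _); rewrite exprVn -[X in z ^+ X / _](subnKC jv) exprD.
by rewrite mulfK // expf_neq0.
Qed.

(** Multiplication by a polynomial of degree nu_(k+1) costs nu_(k+1) terms of
    precision. *)
Lemma expansion_recurrence k f g M : (0 < nu k.+1)%N ->
    (forall i, (i < (nu k.+1).-1)%N -> phi k i = 0) -> b k != 0 ->
    (nu k.+1 <= M)%N ->
    expansion g (residual k) M -> expansion f (residual k.+1) M ->
  expansion (fun z => peval (polynomial_part c nn k) z * f z - (b k)%:C * g z)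
    (residual k.+2) (M - nu k.+1).
Proof.
move=> nu0 low b0 vM gU fU; set v := nu k.+1 in nu0 vM *.
pose A : {poly R} := \poly_(j < v.+1) reversed_part c nn k j.
pose U := partial_sum (residual k) M; pose U1 := partial_sum (residual k.+1) M.
pose U2 := partial_sum (residual k.+2) (M - v).
pose W := 'X^v * U2 - A * U1 + b k *: ('X^v * U).
have W0 i : (i <= M)%N -> W`_i = 0.
  move=> iM; rewrite coefD coefB coefZ !coefXnM.
  have -> : (A * U1)`_i = conv (reversed_part c nn k) (residual k.+1) i.
    apply: conv_poly => j ji; rewrite coef_poly ltnS; last by rewrite (leq_trans ji).
    by case: leqP => // vj; rewrite /reversed_part leqNgt vj.
  have U2E : (if (i < v)%N then 0 else U2`_(i - v)) = shift v (residual k.+2) i.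
    by rewrite /shift; case: ltnP => // vi; rewrite coef_poly ltnS leq_sub.
  have UE : (if (i < v)%N then 0 else U`_(i - v)) = shift v (residual k) i.
    rewrite /shift; case: ltnP => // vi; rewrite coef_poly ltnS.
    by rewrite (leq_trans (leq_subr _ _)).
  by rewrite U2E UE -residual_recurrence //; ring.
have := stolz_limD (stolz_limD (stolz_limM (stolz_lim_peval A) fU)
  (stolz_limM (stolz_lim_peval (- (b k *: 'X^v))) gU)) (stolz_lim_high W0).
rewrite !mulr0 !addr0 => H; apply: (stolz_lim_eq H) => z z0.
rewrite peval_polynomial_part // -/v -/A -/U -/U1 -/U2.
rewrite /W !pevalE; have -> : peval 'X^v z^-1 = z ^- v.
  by rewrite /peval map_polyXn hornerXn exprVn.
have -> : z ^+ M = z ^+ v * z ^+ (M - v) by rewrite -exprD subnKC.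
have : z ^+ v != 0 by rewrite expf_neq0.
move: (z ^+ v) (z ^+ (M - v)) (peval A _) (peval U _) (peval U1 _) (peval U2 _).
move: (f z) (g z) (b k)%:C => fz gz bk x y pA pU pU1 pU2 x0.
by field.
Qed.

Hypothesis nn_gt0 : (0 < nn)%N.
Hypothesis last_normal : nx N = nn.

Lemma Nn_gt0 : (0 < N)%N.
Proof. by case: posnP last_normal => // ->; move: nn_gt0 => /[swap] <-. Qed.

Variable f : R[i] -> R[i].
Hypothesis f_expansion : stolz_eqo f
  (fun z => - \sum_(i < (2 * nn - 2).+1) (c i)%:C / z ^+ i.+1)
  (fun z => (z ^+ (2 * nn - 2).+1)^-1).

(* The remainders R_(k-1) and R_k. *)
Let rem1 k z := f z * peval (P k).1 z - peval (Q k).1 z.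
Let rem2 k z := f z * peval (P k).2 z - peval (Q k).2 z.

Let L := (2 * nn - 2).+1.

Lemma rem2S k z : rem2 k.+1 z = peval (a k) z * rem2 k z - (b k)%:C * rem1 k z.
Proof. by rewrite /rem2 /rem1 /= !pevalE; ring. Qed.

Lemma expansion_rem k : (k < N)%N ->
  expansion (rem1 k) (residual k) (L - nx k) /\
  expansion (rem2 k) (residual k.+1) (L - nx k).
Proof.
elim: k => [|k IHk] kN.
  rewrite subn0; split; rewrite /expansion.
    apply: stolz_lim_eq (stolz_lim_cst 0) _ => z z0; rewrite /rem1 /=.
    have -> : partial_sum (series1 R) L = 1.
      by apply/polyP => -[|i]; rewrite coef_poly coef1 ?if_same.
    by rewrite -polyC0 -polyC1 !pevalC mulr0 sub0r addNr mul0r.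
  have /stolz_eqoP H := f_expansion; apply: (stolz_lim_eq H) => z z0.
  rewrite /rem2 /= -polyC0 -polyC1 !pevalC mulr1 subr0 opprK; congr ((_ + _) * _).
  rewrite convC conv_series1 /partial_sum poly_def /peval rmorph_sum horner_sum.
  rewrite big_ord_recl /= {1}/shift /= scale0r rmorph0 horner0 add0r.
  apply: eq_bigr => i _; rewrite map_polyZ hornerZ map_polyXn hornerXn.
  by rewrite /shift /= /bump /= add1n subn1 exprVn.
have [e1 e2] := IHk (ltnW kN); have inv := formal_invariantP t (ltnW kN).
have [_ _ phi0 b0] := residual_order (ltnW kN) inv.
have nuE : (nx k + nu k.+1 = nx k.+1)%N by rewrite /Defs.nu /= subnKC ?nidx_leq ?(ltnW kN).
have nu0 : (0 < nu k.+1)%N by rewrite /Defs.nu /= subn_gt0 nidx_ltn ?(ltnW kN).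
have nxL : (nx k.+1 <= L)%N by have := nidx_le (ltnW kN); rewrite /L; lia.
rewrite -nuE subnDA; split; first by apply: expansion_leq e2; rewrite leq_subr.
have [e aE e0] := atom_aE_polynomial_part t (ltnW kN) nu0 phi0 b0.
have vL : (nu k.+1 <= L - nx k)%N by lia.
have H := expansion_recurrence nu0 phi0 b0 vL e1 e2.
rewrite /expansion; apply: (stolz_lim_eq H) => z z0.
by rewrite rem2S aE e0 ?addr0 //; lia.
Qed.

Let K := N.-1.
Let KN : (K < N)%N. Proof. by rewrite /K prednK ?Nn_gt0. Qed.
Let KS : K.+1 = N. Proof. by rewrite /K prednK ?Nn_gt0. Qed.

Lemma rem2_leading : exists2 l, l != 0 & stolz_lim (fun z => rem2 K z * z ^+ nn) l.
Proof.
have inv := formal_invariantP t KN; have [low high _ _] := residual_order KN inv.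
have [_ e2] := expansion_rem KN; move: low high e2; rewrite KS last_normal => low high e2.
have nxK : (nx K < nn)%N by rewrite -[X in (_ < X)%N]last_normal nidx_ltn.
have nL : (nn <= L - nx K)%N by rewrite /L; lia.
exists (- (residual N nn)%:C).
  by rewrite oppr_eq0 -[0]/(0%:C) (inj_eq (@complexI _)).
have := stolz_limD (expansion_leq nL e2) (stolz_lim_cst (- (residual N nn)%:C)).
rewrite add0r => H; apply: (stolz_lim_eq H) => z z0.
have -> : partial_sum (residual N) nn = residual N nn *: 'X^nn.
  apply/polyP => i; rewrite coef_poly coefZ coefXn ltnS.
  case: ltngtP => [ii|ii|->]; rewrite ?mulr1 ?mulr0 //.
  by rewrite low.
rewrite pevalZ /peval map_polyXn hornerXn exprVn; field.
by rewrite expf_neq0.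
Qed.

(** The constant by which a_(N-1) differs from the polynomial part contributes a
    multiple of R_(N-1) = O(z^(-nn)), which is negligible. *)
Lemma rem2_last : stolz_lim (fun z => rem2 N z * z ^+ nn.-1) 0.
Proof.
have inv := formal_invariantP t KN; have [low high phi0 b0] := residual_order KN inv.
have nuE : (nx K + nu K.+1 = nx K.+1)%N by rewrite /Defs.nu /= subnKC ?nidx_leq.
have nu0 : (0 < nu K.+1)%N by rewrite /Defs.nu /= subn_gt0 nidx_ltn.
have [e aE _] := atom_aE_polynomial_part t KN nu0 phi0 b0.
have [e1 e2] := expansion_rem KN; have [l _ lim2] := rem2_leading.
have nxN : nx K.+1 = nn by rewrite KS.
have vL : (nu K.+1 <= L - nx K)%N by rewrite /L; lia.
have := expansion_recurrence nu0 phi0 b0 vL e1 e2.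
rewrite -subnDA nuE nxN (_ : L - nn = nn.-1)%N; last by rewrite /L; lia.
rewrite /expansion; have -> : partial_sum (residual K.+2) nn.-1 = 0.
  have low1 i : (i < 1)%N -> shift 1 (phi K.+1) i = 0 by rewrite /shift => ->.
  apply/polyP => i; rewrite coef0 coef_poly ltnS; case: ifP => // iN.
  by apply: (conv_low low1 low).1; rewrite nxN; lia.
move=> H1; have := stolz_limM (stolz_limM lim2 stolz_lim_inv) (stolz_lim_cst e%:C).
rewrite mulr0 mul0r => H2; have := stolz_limD H1 H2; rewrite addr0 => H.
apply: (stolz_lim_eq H) => z z0; rewrite -[N]KS rem2S aE pevalD pevalC -polyC0 pevalC.
have -> : z ^+ nn = z ^+ nn.-1 * z by rewrite -exprSr prednK.
rewrite mulrA mulfK //.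
by ring.
Qed.

(** The parameter tau: the preimage of f(z) under the linear fractional map with
    the Stieltjes polynomials as coefficients. *)
Definition sfrac_parameter z : ecomplex R :=
  ratio (peval (Peven c nn t alpha N.-1) z * f z - peval (Qeven c nn t alpha N.-1) z)
        (peval (Qodd c nn t alpha N) z - peval (Podd c nn t alpha N) z * f z).

Hypothesis alpha_regular : regular c nn t alpha.

Lemma sfrac_parameter_admissible : admissible sfrac_parameter.
Proof.
have b_neq0 k : (k < N)%N -> b k != 0.
  by move=> kN; have [] := residual_order kN (formal_invariantP t kN).
set p0 := (first_kind c nn t K).[alpha].
have p00 : p0 != 0.
  have : (K <= N)%N by apply: ltnW.
  rewrite /p0; case: (K) => [|k] kN; last exact: alpha_regular.
  by rewrite /first_kind /= hornerC oner_eq0.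
set p1 := (first_kind c nn t K.+1).[alpha]; set kap := atom_kappa c nn K.+1.
have evenE z : peval (Peven c nn t alpha N.-1) z * f z - peval (Qeven c nn t alpha N.-1) z
    = (p0^-1)%:C * rem2 K z.
  have -> : Peven c nn t alpha K = p0^-1 *: (P K).2 by exact: stieltjes_even_three_term.
  have -> : Qeven c nn t alpha K = p0^-1 *: (Q K).2 by exact: stieltjes_even_three_term.
  by rewrite !pevalZ /rem2; move: (p0^-1)%:C => q; ring.
have oddE z : peval (Qodd c nn t alpha N) z - peval (Podd c nn t alpha N) z * f z
    = - kap%:C * (p0%:C * rem2 N z - p1%:C * rem2 K z).
  rewrite -[N]KS.
  have -> : Podd c nn t alpha K.+1 = kap *: (p0 *: (P K.+1).2 - p1 *: (P K).2).
    exact: stieltjes_odd_three_term.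
  have -> : Qodd c nn t alpha K.+1 = kap *: (p0 *: (Q K.+1).2 - p1 *: (Q K).2).
    exact: stieltjes_odd_three_term.
  have pevalZB u v w (p q : {poly R}) :
      peval (u *: (v *: p - w *: q)) z = u%:C * (v%:C * peval p z - w%:C * peval q z).
    by rewrite pevalZ pevalD pevalN !pevalZ.
  by rewrite !pevalZB /rem2; ring.
have [l l0 lim2] := rem2_leading.
have p0C : (p0^-1)%:C != 0 :> R[i] by rewrite -[0]/(0%:C) (inj_eq (@complexI _)) invr_eq0.
have limx : stolz_lim (fun z => (p0^-1)%:C * rem2 K z * z ^+ nn) ((p0^-1)%:C * l).
  have H := stolz_limM (stolz_lim_cst (p0^-1)%:C) lim2.
  by apply: (stolz_lim_eq H) => z _; rewrite mulrA.
have limx0 : (p0^-1)%:C * l != 0 by rewrite mulf_neq0.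
split.
  move=> theta t0 tpi; apply: filterS (stolz_lim_neq0 limx limx0 t0 tpi) => z.
  rewrite mulf_eq0 negb_or /sfrac_parameter evenE => /andP[x0 _].
  by rewrite einv_ratio ?x0 // /ratio (negPf x0).
have limy : stolz_lim (fun z => (- kap%:C * (p0%:C * rem2 N z - p1%:C * rem2 K z)) *
    z ^+ nn.-1) 0.
  have H1 := stolz_limM (stolz_lim_cst (- kap%:C * p0%:C)) rem2_last.
  have H2 := stolz_limM (stolz_lim_cst (kap%:C * p1%:C)) (stolz_limM lim2 stolz_lim_inv).
  have := stolz_limD H1 H2; rewrite !mulr0 addr0 => H; apply: (stolz_lim_eq H) => z z0.
  have -> : z ^+ nn = z ^+ nn.-1 * z by rewrite -exprSr prednK.
  rewrite [rem2 K z * _]mulrA mulfK //; by ring.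
apply: stolz_eqo0_idP; have := stolz_limM limy (stolz_limV limx0 limx); rewrite mul0r => H.
apply: (stolz_lim_eq H) => z z0; rewrite /sfrac_parameter evenE oddE.
rewrite finite_part_einv_ratio.
have -> : z ^+ nn = z ^+ nn.-1 * z by rewrite -exprSr prednK.
set y := - _ * _; set x := _ * rem2 K z; have : z ^+ nn.-1 != 0 by rewrite expf_neq0.
move: y x (z ^+ nn.-1) => y x q q0.
rewrite !invfM -!mulrA; congr (y * _); rewrite [RHS]mulrCA; congr (x^-1 * _).
by rewrite mulrA mulfV ?mul1r.
Qed.

Lemma sfrac_sfrac_parameter z :
  sfrac c nn t alpha z (sfrac_parameter z) = Some (f z) /\
  sfrac_mobius c nn t alpha z (sfrac_parameter z) = Some (f z).
Proof.
rewrite sfrac_sfrac_mobius ?Nn_gt0 //; split; exact: sfrac_mobius_inv Nn_gt0 _ _.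
Qed.

End OneVariable.

Theorem theorem4p8 (R : realType) (n nn : nat) (nn_gt0 : (0 < nn)%N)
    (s : n.+1.-tuple 'I_(2 * nn - 2).+1 -> R)
    (alpha t : mindex n (2 * nn - 2) -> R)
    (last_normal : forall J,
       nidx (associated s J) nn (Nn (associated s J) nn) = nn)
    (alpha_regular : forall J,
       regular (associated s J) nn (t J) (alpha J))
    (F : n.+1.-tuple R[i] -> R[i]) (F_sol : MP_solution s F) :
  exists tau : mindex n (2 * nn - 2) -> R[i] -> ecomplex R,
    [/\ forall J, admissible (tau J),
        represents F (fun J z =>
          sfrac (associated s J) nn (t J) (alpha J) z (tau J z))
      & represents F (fun J z =>
          sfrac_mobius (associated s J) nn (t J) (alpha J) z (tau J z))].
Proof.
have [FJ [FE FJE]] := F_sol.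
pose tau J := sfrac_parameter (associated s J) nn (t J) (alpha J) (FJ J).
have tauP J z := @sfrac_sfrac_parameter R _ nn (t J) (alpha J) nn_gt0 (last_normal J) (FJ J) z.
exists tau; split=> [J|z zup|z zup].
- exact: sfrac_parameter_admissible.
- split=> [J|]; first by rewrite (tauP J _).1.
  by rewrite FE //; apply: eq_bigr => J _; rewrite (tauP J _).1.
- split=> [J|]; first by rewrite (tauP J _).2.
  by rewrite FE //; apply: eq_bigr => J _; rewrite (tauP J _).2.
Qed.
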